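(* Let $n$, $k=k(n)\geq 2$ and $w=w(n)\geq 64$ be integers such that $\sqrt{w}/(\log_2 k\log_2 w)\geq 1$ and $$2kw\bigl(2w+\lceil \log_2 k\rceil+\lceil \log_2 (2w)\rceil\bigr)<n.$$ Then there is a Boolean function $f:\{0,1\}^n\to\{0,1\}$ such that $$f\in k\text{-}\mathbf{OBDD}_{3w+1}\cap k\text{-}\mathbf{NOBDD}_{3w+1}\cap k\text{-}\mathbf{POBDD}_{3w+1}$$ and $$f\notin k\text{-}\mathbf{OBDD}_{\lfloor w/16\rfloor-3},\quad f\notin k\text{-}\mathbf{NOBDD}_{\sqrt{w}/2},\quad f\notin k\text{-}\mathbf{POBDD}_{\sqrt{w}/(\log_2 k\log_2 w)}.$$
   Context: Let $x_1,\dots,x_n$ be Boolean variables and $\pi$ a permutation of $\{1,\dots,n\}$. An OBDD with order $\pi$ is a leveled directed acyclic graph with levels $V_1,\dots,V_{n+1}$, a source in $V_1$ and sinks in $V_{n+1}$, in which all nodes of $V_j$ ($j\le n$) are labeled by $x_{\pi(j)}$ and have outgoing edges only into $V_{j+1}$. A $k$-OBDD with order $\pi$ consists of $k$ consecutive layers, each an OBDD with the same order $\pi$; its width is the maximum number of nodes in a level. Deterministic: each inner node has exactly one outgoing edge labeled $0$ and one labeled $1$, and $f(\sigma)=1$ iff the path consistent with $\sigma$ reaches the accepting sink. Nondeterministic ($k$-NOBDD): any number of outgoing edges per label, and $f(\sigma)=1$ iff some path consistent with $\sigma$ reaches the accepting sink. Probabilistic ($k$-POBDD): the next node is chosen at random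 among the edges consistent with the tested bit according to fixed probabilities; it computes $f$ with bounded error if for some $\varepsilon>0$ inputs with $f(\sigma)=1$ are accepted with probability $\ge 1/2+\varepsilon$ and inputs with $f(\sigma)=0$ with probability $\le 1/2-\varepsilon$. $k\text{-}\mathbf{OBDD}_W$, $k\text{-}\mathbf{NOBDD}_W$, $k\text{-}\mathbf{POBDD}_W$ denote the sets of Boolean functions on $n$ variables computed by a deterministic, nondeterministic, resp. bounded-error probabilistic $k$-OBDD (with some order) of width at most $W$. *)

(* Defs.v *)
From HB Require Import structures.
From mathcomp Require Import all_boot all_order all_algebra perm.
From mathcomp Require Import reals exp.
Set Implicit Arguments.
Unset Strict Implicit.
Unset Printing Implicit Defensive.
Import Order.TTheory GRing.Theory Num.Theory.
Local Open Scope ring_scope.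

(* A graph with levels 0, ..., h. The sinks are the nodes of level h, each
   either accepting or rejecting; merging all accepting sinks into a single one
   does not increase the width. *)
Record leveled_graph (h : nat) := LeveledGraph {
  node :> finType;
  level : node -> 'I_h.+1;
  source : node;
  accepting : {set node};
  level_source : level source = ord0;
  level_accepting : forall v, v \in accepting -> level v = ord_max
}.

Definition width (h : nat) (G : leveled_graph h) : nat :=
  \max_(t < h.+1) #|[set v : G | level v == t]|.

(* k consecutive layers of n tests, the last level of a layer being the first
   level of the next one: levels 0, ..., k * n in total, where the nodes of
   level t < k * n test the variable pi (t %% n). The default value of nth is
   never used, as k * n = 0 when n = 0. *)
Definition tested_bit (n : nat) (pi : {perm 'I_n}) (s : n.-tuple bool)
    (t : nat) : bool :=
  nth false [seq tnth s (pi j) | j <- enum 'I_n] (t %% n).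

Record knobdd (n k : nat) := KNobdd {
  nobdd_graph :> leveled_graph (k * n);
  nobdd_order : {perm 'I_n};
  nobdd_edge : bool -> rel nobdd_graph;
  nobdd_edge_level : forall b u v,
    nobdd_edge b u v -> level v = (level u).+1 :> nat
}.

Definition consistent (n k : nat) (P : knobdd n k) (s : n.-tuple bool) :
    rel P :=
  fun u v => nobdd_edge (tested_bit (nobdd_order P) s (level u)) u v.

Definition accepts (n k : nat) (P : knobdd n k) (s : n.-tuple bool) : Prop :=
  exists p : seq P,
    path (consistent s) (source P) p /\ last (source P) p \in accepting P.

Definition deterministic (n k : nat) (P : knobdd n k) : Prop :=
  forall (u : P) (b : bool), (level u < k * n)%N ->
    #|[set v | nobdd_edge b u v]| = 1%N.

Record kpobdd (R : realType) (n k : nat) := KPobdd {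
  pobdd_graph :> leveled_graph (k * n);
  pobdd_order : {perm 'I_n};
  pobdd_prob : bool -> pobdd_graph -> pobdd_graph -> R;
  pobdd_prob_ge0 : forall b u v, 0 <= pobdd_prob b u v;
  pobdd_prob_level : forall b u v,
    pobdd_prob b u v != 0 -> level v = (level u).+1 :> nat;
  pobdd_prob_sum1 : forall b u, (level u < k * n)%N ->
    \sum_v pobdd_prob b u v = 1
}.

(* The distribution of the current node after t tests on input s. *)
Fixpoint reach_prob (R : realType) (n k : nat) (P : kpobdd R n k)
    (s : n.-tuple bool) (t : nat) (v : P) : R :=
  if t is t'.+1 then
    \sum_u reach_prob s t' u *
           pobdd_prob (tested_bit (pobdd_order P) s (level u)) u v
  else (v == source P)%:R.

Definition accept_prob (R : realType) (n k : nat) (P : kpobdd R n k)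
    (s : n.-tuple bool) : R :=
  \sum_(v in accepting P) reach_prob s (k * n) v.

Definition bounded_error (R : realType) (n k : nat) (P : kpobdd R n k)
    (f : n.-tuple bool -> bool) : Prop :=
  exists2 e : R, 0 < e &
    forall s, if f s then 1 / 2 + e <= accept_prob P s
              else accept_prob P s <= 1 / 2 - e.

(* The complexity classes; the width bound W may be any real number. *)
Definition kOBDD (R : realType) (n k : nat) (W : R)
    (f : n.-tuple bool -> bool) : Prop :=
  exists P : knobdd n k, [/\ deterministic P, (width P)%:R <= W &
                             forall s, f s <-> accepts P s].

Definition kNOBDD (R : realType) (n k : nat) (W : R)
    (f : n.-tuple bool -> bool) : Prop :=
  exists P : knobdd n k, (width P)%:R <= W /\ forall s, f s <-> accepts P s.

Definition kPOBDD (R : realType) (n k : nat) (W : R)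
    (f : n.-tuple bool -> bool) : Prop :=
  exists P : kpobdd R n k, (width P)%:R <= W /\ bounded_error P f.

Definition log2 (R : realType) (x : R) : R := ln x / ln 2.

(* Main.v *)
Require Import Defs.
From mathcomp Require Import all_boot all_order all_algebra perm.
From mathcomp Require Import reals sequences exp.
From mathcomp Require Import zify ring lra.
Set Implicit Arguments.
Unset Strict Implicit.
Unset Printing Implicit Defensive.
Import Order.TTheory GRing.Theory Num.Theory.
Local Open Scope ring_scope.

(** For a suitable [d], let [f] be the function computed by an automaton with
    [4 ^ (d + 1) <= 3 w + 1] states that reads the input [k] times. The input
    is a list of items, each carrying the number of the pass in which it is
    active, so that for every variable order some cut of the order embeds the
    following communication problem on [2 k - 1] blocks of [2 d] bits: evaluate
    a nondegenerate quadratic form at [x + y], where [x] is known before the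
    cut and [y] after it. The matrix [(-1)^f(x, y)] is then a Hadamard matrix
    of order [N = 4 ^ ((2 k - 1) d)].

    A [k]-layer diagram of width [W] crosses the cut [2 k - 1] times, so its
    number of accepting paths, or its acceptance probability, is a nonnegative
    matrix of nonnegative rank at most [W ^ (2 k - 1)]. For nondeterministic
    diagrams this covers the ones of [f] by [W ^ (2 k - 1)] rectangles, each of
    size at most [N]. For probabilistic ones it bounds the sign rank of [f] by
    [W ^ (2 k - 1) + 1], while by Forster's theorem this sign rank is at least
    [sqrt N / 3]; the argument is insensitive to the size of the error gap. *)

(** * Forster's sign-rank bound *)

(** Lagrange's identity: the gap is half the sum over all [i], [j] of the squared 2 x 2 minors. *)
Lemma sum_cauchy_schwarz (R : realFieldType) (I : finType) (a b : I -> R) :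
  (\sum_i a i * b i) ^+ 2 <= (\sum_i a i ^+ 2) * (\sum_i b i ^+ 2).
Proof.
suff -> : (\sum_i a i ^+ 2) * (\sum_i b i ^+ 2) =
  (\sum_i a i * b i) ^+ 2 + (\sum_i \sum_j (a i * b j - a j * b i) ^+ 2) / 2.
  by rewrite lerDl divr_ge0 //; do 2!apply: sumr_ge0 => ? _; exact: sqr_ge0.
have eij i j : (a i * b j - a j * b i) ^+ 2 = a i ^+ 2 * b j ^+ 2 +
    (b i ^+ 2 * a j ^+ 2 + (- 2 * (a i * b i)) * (a j * b j)) by ring.
under [X in _ + X / _]eq_bigr => i _.
  under eq_bigr => j _ do rewrite eij.
  rewrite !big_split /= -!mulr_sumr.
  over.
rewrite !big_split /= -!mulr_suml -mulr_sumr.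
set A := \sum_i a i ^+ 2; set B := \sum_i b i ^+ 2.
set C := \sum_i a i * b i; by field.
Qed.

Lemma sqr_sum_le (R : realFieldType) (I : finType) (A : {pred I})
    (a : I -> R) :
  (\sum_(i in A) a i) ^+ 2 <= #|A|%:R * \sum_i a i ^+ 2.
Proof.
have := sum_cauchy_schwarz (fun i => (i \in A)%:R) a.
under eq_bigr do rewrite mulr_natl mulrb.
rewrite -big_mkcond.
under [in X in _ <= X * _]eq_bigr do rewrite -natrX -mulnn mulnb andbb.
by rewrite -natr_sum -big_mkcond sum1_card.
Qed.

(** A weak Hadamard inequality: each of the [r!] Leibniz terms is at most the product of the row
    norms. The loss of [r!] is harmless, as the bound only serves to keep a potential bounded. *)
Lemma sqr_det_le (R : rcfType) (r : nat) (B : 'M[R]_r) :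
  (\det B) ^+ 2 <= (r`!)%:R ^+ 2 * \prod_i \sum_j B i j ^+ 2.
Proof.
set P := \prod_i _.
have P0 : 0 <= P by apply: prodr_ge0 => i _; apply: sumr_ge0 => j _; exact: sqr_ge0.
have le_term (s : {perm 'I_r}) : `|\prod_i B i (s i)| <= Num.sqrt P.
  rewrite -(ler_pXn2r (n := 2)) ?nnegrE ?sqrtr_ge0 // sqr_sqrtr //.
  rewrite real_normK ?num_real // -prodrXl; apply: ler_prod => i _.
  by rewrite sqr_ge0 (bigD1 (s i)) //= lerDl sumr_ge0 // => j _; exact: sqr_ge0.
rewrite -(sqr_sqrtr P0) -exprMn -real_normK ?num_real //.
rewrite ler_pXn2r ?nnegrE ?mulr_ge0 ?sqrtr_ge0 //.
apply: le_trans (ler_norm_sum _ _ _) _.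
rewrite -card_Sn mulr_natl -sumr_const; apply: ler_sum => s _.
by rewrite normrM normrX normrN1 expr1n mul1r.
Qed.

(** One bordered matrix is factored into block triangular matrices in two ways. *)
Lemma det_add_rank1 (R : comNzRingType) (r : nat) (v : 'rV[R]_r) :
  \det (1%:M + v^T *m v) = 1 + (v *m v^T) 0 0.
Proof.
pose B := block_mx (1%:M : 'M[R]_1) (- v) v^T (1%:M : 'M[R]_r).
have B1 : B = block_mx 1%:M 0 v^T 1%:M *m
              block_mx 1%:M (- v) 0 (1%:M + v^T *m v).
  rewrite mulmx_block !(mul1mx, mulmx1, mulmx0, mul0mx, addr0, add0r, mulmxN).
  by rewrite addrCA addNr addr0.
have B2 : B = block_mx 1%:M (- v) 0 1%:M *m
              block_mx (1%:M + v *m v^T) 0 v^T 1%:M.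
  rewrite mulmx_block !(mul1mx, mulmx1, mulmx0, mul0mx, addr0, add0r, mulNmx).
  by rewrite addrK.
have : \det B = \det B by [].
rewrite {1}B1 B2 !det_mulmx !(det_ublock, det_lblock) !det1 !(mul1r, mulr1).
by move=> ->; rewrite det_mx11 !mxE eqxx.
Qed.

Lemma expR1_lt4 (R : realType) : expR 1 < 4 :> R.
Proof.
have := expR_ge1Dx (- (1 / 4) : R).
rewrite expRN => h.
have e0 : 0 < expR (1 / 4) :> R by exact: expR_gt0.
have e43 : expR (1 / 4) <= 4 / 3 :> R.
  rewrite -lef_pV2 ?posrE //; last by lra.
  by apply: le_trans h; lra.
have -> : expR 1 = expR (1 / 4) ^+ 4 :> R.
  by rewrite -expRM_natl; congr expR; field.
have lt44 : (4 / 3) ^+ 4 < 4 :> R.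
  by have -> : (4 / 3) ^+ 4 = 256 / 81 :> R by [field]; lra.
apply: (le_lt_trans _ lt44).
by rewrite ler_pXn2r ?nnegrE ?expR_ge0 // divr_ge0.
Qed.

Definition row_sqr (R : realFieldType) (m r : nat) (A : 'M[R]_(m, r)) i : R :=
  \sum_j A i j ^+ 2.

(* Addition of indices is modulo [N.+1], so the windows wrap around. *)
Definition window (R : nzRingType) (N r : nat) (U : 'M[R]_(N.+1, r))
    (i : 'I_N.+1) : 'M[R]_r :=
  \matrix_(j, l) U (i + inord j) l.

Lemma row_sqr_ge0 (R : realFieldType) (m r : nat) (A : 'M[R]_(m, r)) i :
  0 <= row_sqr A i.
Proof. by apply: sumr_ge0 => j _; exact: sqr_ge0. Qed.

Lemma prod_windows (R : comNzRingType) (N r : nat) (g : 'I_N.+1 -> R) :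
  \prod_i \prod_(j < r) g (i + inord j) = (\prod_i g i) ^+ r.
Proof.
rewrite exchange_big /= (eq_bigr (fun=> \prod_i g i)) => [|j _].
  by rewrite prodr_const card_ord.
by rewrite [RHS](reindex_inj (addIr (inord j))).
Qed.

(** Hadamard's bound for every window of [U *m A]; each index lies in [r] cyclic windows. This
    bounds the potential used below independently of [A]. *)
Lemma det_windows_le (R : rcfType) (N r : nat) (U : 'M[R]_(N.+1, r))
    (A : 'M[R]_r) :
  (\prod_i \det (window U i) ^+ 2) * (\det A ^+ 2) ^+ N.+1 <=
  ((r`!)%:R ^+ 2) ^+ N.+1 * (\prod_i row_sqr (U *m A) i) ^+ r.
Proof.
rewrite -prod_windows.
have -> (x : R) : x ^+ N.+1 = \prod_(i < N.+1) x by rewrite prodr_const card_ord.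
rewrite [X in _ <= X * _]( _ : _ = \prod_(i < N.+1) (r`!)%:R ^+ 2); last first.
  by rewrite prodr_const card_ord.
rewrite -!big_split; apply: ler_prod => i _ /=.
rewrite -exprMn sqr_ge0 -det_mulmx (le_trans (sqr_det_le _)) //.
rewrite le_eqVlt; apply/orP; left; apply/eqP; congr (_ * _).
apply: eq_bigr => j _; apply: eq_bigr => l _; congr (_ ^+ 2).
by rewrite !mxE; apply: eq_bigr => t _; rewrite mxE.
Qed.

(** The map [1%:M + v^T *m v] doubles the component along the unit vector [v], so the square of that
    component counts four times. *)
Lemma row_sqr_rank1 (R : realFieldType) (m r : nat) (B : 'M[R]_(m, r))
    (v : 'rV[R]_r) i : (v *m v^T) 0 0 = 1 ->
  row_sqr (B *m (1%:M + v^T *m v)) i = row_sqr B i + 3 * (B *m v^T) i 0 ^+ 2.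
Proof.
move=> v1; set t := (B *m v^T) i 0.
have E j : (B *m (1%:M + v^T *m v)) i j = B i j + t * v 0 j.
  rewrite mulmxDr mulmx1 mulmxA mxE; congr (_ + _).
  by rewrite mxE big_ord1.
rewrite /row_sqr; under eq_bigr do rewrite E sqrrD.
rewrite 2!big_split /= -addrA; congr (_ + _).
have -> : \sum_j (t * v 0 j) ^+ 2 = t ^+ 2.
  under eq_bigr do rewrite exprMn.
  rewrite -mulr_sumr -[RHS]mulr1 -v1 mxE; congr (_ * _).
  by apply: eq_bigr => j _; rewrite mxE expr2.
have -> : \sum_j (B i j * (t * v 0 j)) *+ 2 = t ^+ 2 *+ 2.
  rewrite sumrMnl; congr (_ *+ 2).
  under eq_bigr do rewrite mulrCA.
  rewrite -mulr_sumr expr2 {3}/t mxE; congr (_ * _).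
  by apply: eq_bigr => j _; rewrite mxE.
by ring.
Qed.

Lemma prod_1D_le_expR (R : realType) (I : finType) (a : I -> R) :
  (forall i, 0 <= a i) -> \prod_i (1 + a i) <= expR (\sum_i a i).
Proof.
move=> a0; rewrite expR_sum; apply: ler_prod => i _.
by rewrite expR_ge1Dx andbT addr_ge0.
Qed.

(** Stands in for a maximiser, which need not exist. *)
Lemma exists_near_sup (R : realType) (E : classical_sets.set R) (q : R) :
  0 <= q < 1 -> classical_sets.has_sup E -> (exists2 x, E x & 0 < x) ->
  exists2 x, E x & forall y, E y -> q * y < x.
Proof.
move=> /andP[q0 q1] hE [x0 Ex0 x0_gt0].
have s0 : 0 < sup E by apply: lt_le_trans x0_gt0 _; exact: sup_ubound hE.2 _ Ex0.
have [|x Ex lt_x] := @sup_adherent R E ((1 - q) * sup E) _ hE.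
  by rewrite mulr_gt0 // subr_gt0.
exists x => // y Ey; apply: le_lt_trans lt_x.
have -> : sup E - (1 - q) * sup E = q * sup E by ring.
by rewrite ler_wpM2l //; exact: sup_ubound hE.2 _ Ey.
Qed.

Lemma prod_row_sqr_gt0 (R : rcfType) (N r : nat) (U : 'M[R]_(N.+1, r.+1))
    (A : 'M[R]_r.+1) : (forall i, \det (window U i) != 0) -> \det A != 0 ->
  0 < \prod_i row_sqr (U *m A) i.
Proof.
move=> hU hA; rewrite lt0r; apply/andP; split; last first.
  by apply: prodr_ge0 => i _; exact: row_sqr_ge0.
apply/eqP => P0; have := det_windows_le U A; rewrite P0 expr0n mulr0.
apply/negP; rewrite -ltNge mulr_gt0 //.
  by apply: prodr_gt0 => i _; rewrite exprn_even_gt0 ?hU.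
by rewrite exprn_gt0 // exprn_even_gt0.
Qed.

(* A near-maximiser [A] of the potential [|\det A|^(2N) / \prod_i |u_i A|^(2r)]
   works: if the bound failed in direction [v], stretching [v] by a factor 2
   would multiply the potential by at least [(4/e)^N]. *)
Lemma exists_near_isotropic (R : realType) (N r : nat)
    (U : 'M[R]_(N.+1, r.+1)) :
  (forall i, \det (window U i) != 0) ->
  exists2 A : 'M[R]_r.+1, A \in unitmx & forall v : 'rV[R]_r.+1,
    (v *m v^T) 0 0 = 1 ->
    N.+1%:R / (3 * r.+1%:R) <=
      \sum_i (U *m A *m v^T) i 0 ^+ 2 / row_sqr (U *m A) i.
Proof.
move=> hU.
pose P (A : 'M[R]_r.+1) := \prod_i row_sqr (U *m A) i.
pose C := \prod_i \det (window U i) ^+ 2.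
pose K : R := ((r.+1`!)%:R ^+ 2) ^+ N.+1.
pose Phi (A : 'M[R]_r.+1) := (\det A ^+ 2) ^+ N.+1 / P A ^+ r.+1.
have C0 : 0 < C by apply: prodr_gt0 => i _; rewrite exprn_even_gt0 ?hU.
have P0 A : A \in unitmx -> 0 < P A.
  by rewrite unitmxE unitfE; exact: prod_row_sqr_gt0.
have Phi0 A : A \in unitmx -> 0 < Phi A.
  move=> uA; rewrite divr_gt0 //; last by rewrite exprn_gt0 // P0.
  by apply: exprn_gt0; rewrite exprn_even_gt0 //= -unitfE -unitmxE.
pose E : classical_sets.set R := fun x => exists2 A, A \in unitmx & x = Phi A.
(* The stretch considered below would gain a factor of at least [1 / q], so being within a factor
   [q] of the supremum rules it out. *)
pose q : R := (expR 1 / 4) ^+ N.+1.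
have e4 : 0 <= expR 1 / 4 :> R by rewrite divr_ge0 ?expR_ge0.
have [] := @exists_near_sup R E q.
- rewrite exprn_ge0 // exprn_ilt1 //.
  by rewrite ltr_pdivrMr // mul1r expR1_lt4.
- split; first by exists (Phi 1%:M), 1%:M => //; exact: unitmx1.
  exists (K / C) => _ [A uA ->].
  rewrite ler_pdivrMr ?exprn_gt0 ?P0 // mulrAC ler_pdivlMr // mulrC.
  exact: det_windows_le.
- by exists (Phi 1%:M); [exists 1%:M => //; exact: unitmx1 | rewrite Phi0 ?unitmx1].
move=> _ [A uA ->] near_sup.
exists A => // v v1; rewrite leNgt; apply/negP => lt_sum.
set a := fun i => (U *m A *m v^T) i 0 ^+ 2 / row_sqr (U *m A) i.
have a0 i : 0 <= 3 * a i.
  by rewrite mulr_ge0 // divr_ge0 ?sqr_ge0 ?row_sqr_ge0.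
pose A' := A *m (1%:M + v^T *m v).
have dA' : \det A' = 2 * \det A.
  by rewrite det_mulmx det_add_rank1 v1 mulrC.
have uA' : A' \in unitmx.
  by rewrite unitmxE dA' unitrM -unitmxE uA unitfE pnatr_eq0.
have rs_gt0 i : 0 < row_sqr (U *m A) i.
  rewrite lt0r row_sqr_ge0 andbT.
  by have /lt0r_neq0/prodf_neq0 := P0 _ uA; apply.
pose Z := \prod_i (1 + 3 * a i).
have PA' : P A' = P A * Z.
  rewrite -big_split; apply: eq_bigr => i _ /=.
  rewrite mulmxA row_sqr_rank1 // mulrDr mulr1 /a.
  by field; rewrite gt_eqF.
have Z0 : 0 < Z.
  by apply: prodr_gt0 => i _; rewrite ltr_wpDr ?a0.
(* By [1 + t <= expR t], [Z] is at most the exponential of the sum of all [3 * a i]; the assumed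
   failure bounds [r.+1] times this sum by [N.+1]. *)
have leZ : Z ^+ r.+1 <= expR 1 ^+ N.+1.
  apply: (@le_trans _ _ (expR (\sum_i 3 * a i) ^+ r.+1)).
    rewrite ler_pXn2r ?nnegrE ?expR_ge0 ?(ltW Z0) //.
    exact: prod_1D_le_expR.
  rewrite -!expRM_natl ler_expR mulr1 -mulr_sumr.
  move/ltW: lt_sum; rewrite ler_pdivlMr ?mulr_gt0 ?ltr0n //.
  by rewrite mulrCA mulrA mulrC.
have EA' : E (Phi A') by exists A'.
have := near_sup _ EA'.
rewrite ltNge /Phi dA' PA' /q => /negP[].
have -> : (expR 1 / 4) ^+ N.+1 * (((2 * \det A) ^+ 2) ^+ N.+1 / (P A * Z) ^+ r.+1)
   = Phi A * (expR 1 ^+ N.+1 / Z ^+ r.+1).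
  have -> : (2 * \det A) ^+ 2 = 4 * \det A ^+ 2 by ring.
  rewrite /Phi !exprMn exprVn invfM.
  by field; rewrite !expf_neq0 ?pnatr_eq0 ?gt_eqF ?P0.
by rewrite ler_peMr ?(ltW (Phi0 _ uA)) // ler_pdivlMr ?exprn_gt0 // mul1r.
Qed.

Lemma exists_nonroot (R : realFieldType) (p : {poly R}) (T : R) :
  p != 0 -> exists2 x, T <= x & p.[x] != 0.
Proof.
move=> p0; pose s := [seq T + i%:R | i <- iota 0 (size p)].
have [/allP h|] := boolP (all (root p) s).
  have : uniq s.
    by rewrite map_inj_uniq ?iota_uniq // => i j /addrI /(mulrIn (oner_neq0 R)).
  move/(max_poly_roots p0 (introT allP h)).
  by rewrite size_map size_iota ltnn.
by case/allPn => _ /mapP[i _ ->] nr; exists (T + i%:R) => //; rewrite lerDl.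
Qed.

(** With rows on the moment curve a window is a transposed Vandermonde matrix, and [r <= N.+1] keeps
    its cyclic nodes distinct. *)
Lemma det_window_moment (R : numFieldType) (N r : nat) i : (r <= N.+1)%N ->
  \det (window (\matrix_(i < N.+1, l < r) (i%:R : R) ^+ l) i) != 0.
Proof.
move=> rN; pose a : 'rV[R]_r := \row_j ((i + inord j)%R : 'I_N.+1)%:R.
have -> : window (\matrix_(i < N.+1, l < r) (i%:R : R) ^+ l) i = (Vandermonde r a)^T.
  by apply/matrixP => j l; rewrite !mxE.
rewrite det_tr det_Vandermonde; apply/prodf_neq0 => j _; apply/prodf_neq0 => l jl.
rewrite !mxE subr_eq0 eqr_nat; apply/negP => /eqP /val_inj /addrI e.
move: jl; rewrite -[val j](@inordK N) ?(leq_trans (ltn_ord j)) //.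
by rewrite -[val l](@inordK N) ?(leq_trans (ltn_ord l)) // e ltnn.
Qed.

(** [U] becomes [x *: U + G] with [G] on the moment curve. The product of the window determinants is
    a polynomial in [x] that is nonzero at 0, so it has large non-roots; a large [x] also preserves
    the signs of [U *m V]. *)
Lemma perturb_windows (R : realFieldType) (N r : nat) (H : 'M[R]_N.+1)
    (U : 'M[R]_(N.+1, r)) (V : 'M[R]_(r, N.+1)) : (r <= N.+1)%N ->
  (forall i j, 0 < H i j * (U *m V) i j) ->
  exists2 U' : 'M[R]_(N.+1, r), (forall i, \det (window U' i) != 0) &
    forall i j, 0 < H i j * (U' *m V) i j.
Proof.
move=> rN hUV; pose G : 'M[R]_(N.+1, r) := \matrix_(i, l) i%:R ^+ l.
pose p i := \det ('X *: map_mx polyC (window U i) + map_mx polyC (window G i)).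
have pE i x : (p i).[x] = \det (window (x *: U + G) i).
  rewrite -/(horner_eval x _) /p -det_map_mx; congr (\det _).
  by apply/matrixP => j l; rewrite !mxE /= /horner_eval !hornerE.
have p0 : \prod_i p i != 0.
  apply/prodf_neq0 => i _; apply/eqP => pi0.
  have := pE i 0; rewrite pi0 horner0 scale0r add0r => /esym/eqP.
  by apply/negP; exact: det_window_moment.
pose T := 1 + \sum_i \sum_j `|H i j * (G *m V) i j| / (H i j * (U *m V) i j).
have [x Tx px] := exists_nonroot T p0.
exists (x *: U + G) => [i|i j].
  by move: px; rewrite horner_prod => /prodf_neq0/(_ i isT); rewrite pE.
have hij := hUV i j; set h := H i j * (U *m V) i j in hij.
have -> : H i j * ((x *: U + G) *m V) i j = x * h + H i j * (G *m V) i j.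
  by rewrite mulmxDl -scalemxAl mxE mulrDr mxE mulrCA.
set g := H i j * _.
have : 1 + `|g| / h <= x.
  apply: le_trans Tx; rewrite lerD2l (bigD1 i) //= (bigD1 j) //= -addrA lerDl.
  by rewrite addr_ge0 // ?sumr_ge0 // => i' _; rewrite ?sumr_ge0 // => *; rewrite divr_ge0 // ltW.
rewrite -(ler_pM2r hij) mulrDl mul1r divfK ?gt_eqF // => hx.
have := ler_norm (- g); rewrite normrN; lra.
Qed.

(** Forster's argument. After a change of basis, rows and columns are scaled to unit vectors [a i],
    [b j] whose inner products [G i j] keep their signs. Near isotropy makes every column sum of
    [|G i j|] at least [N.+1 / (3 * r)], whereas orthogonality of [H] bounds the mean square of
    these sums by [N.+1]. *)
Lemma sign_rank_hadamard (R : realType) (N r : nat) (H : 'M[R]_N.+1)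
    (U : 'M[R]_(N.+1, r)) (V : 'M[R]_(r, N.+1)) :
  (forall i j, H i j ^+ 2 = 1) ->
  (forall i i', \sum_j H i j * H i' j = N.+1%:R * (i == i')%:R) ->
  (forall i j, 0 < H i j * (U *m V) i j) -> (N.+1 <= 9 * r ^ 2)%N.
Proof.
move=> Hsq Horth hUV.
have [rN|/ltnW] := leqP r N.+1; last by nia.
have [U' hU' {U hUV}] := perturb_windows rN hUV.
case: r V U' hU' {rN} => [V U' _ /(_ 0 0)|r V U hU hUV].
  by rewrite mxE big_ord0 mulr0 ltxx.
have [A uA hA] := exists_near_isotropic hU.
pose B := U *m A; pose V' := invmx A *m V.
have BV : B *m V' = U *m V by rewrite mulmxA mulmxK.
have B0 i : 0 < row_sqr B i.
  have := @prod_row_sqr_gt0 R N r U A hU.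
  rewrite -unitfE -unitmxE => /(_ uA); rewrite lt0r => /andP[/prodf_neq0 h _].
  by rewrite lt0r h //= row_sqr_ge0.
rewrite -/B in hA; clearbody B V'.
have V0 j : 0 < row_sqr V'^T j.
  rewrite lt0r row_sqr_ge0 andbT; apply/eqP => e0.
  have := hUV 0 j; rewrite -BV mxE big1 ?mulr0 ?ltxx // => l _.
  suff -> : V' l j = 0 by rewrite mulr0.
  move/eqP: e0; rewrite psumr_eq0 => [/allP /(_ l)|*]; last exact: sqr_ge0.
  by rewrite mem_index_enum mxE sqrf_eq0 => /(_ isT)/eqP.
pose a i l := B i l / Num.sqrt (row_sqr B i).
pose b j l := V' l j / Num.sqrt (row_sqr V'^T j).
pose G i j := \sum_l a i l * b j l.
have a1 i : \sum_l a i l ^+ 2 = 1.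
  under eq_bigr do rewrite expr_div_n sqr_sqrtr ?row_sqr_ge0 //.
  by rewrite -mulr_suml -/(row_sqr B i) divff // gt_eqF.
have b1 j : \sum_l b j l ^+ 2 = 1.
  under eq_bigr do rewrite expr_div_n sqr_sqrtr ?row_sqr_ge0 //.
  rewrite -mulr_suml (_ : \sum_l _ = row_sqr V'^T j).
    by rewrite divff // gt_eqF.
  by apply: eq_bigr => l _; rewrite mxE.
have GE i j : G i j = (U *m V) i j /
    (Num.sqrt (row_sqr B i) * Num.sqrt (row_sqr V'^T j)).
  rewrite -BV mxE mulr_suml; apply: eq_bigr => l _.
  by rewrite /a /b invfM mulrACA.
(* [H i j * G i j] is [|G i j|], at most 1, hence at least its own square, which isotropy
   controls. *)
have HG0 i j : 0 < H i j * G i j.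
  by rewrite GE mulrA divr_gt0 // mulr_gt0 // sqrtr_gt0.
have G1 i j : (H i j * G i j) ^+ 2 <= H i j * G i j.
  rewrite expr2 ler_piMr //; first by rewrite ltW.
  rewrite -(ler_pXn2r (n := 2)) ?nnegrE ?ler01 //; last by rewrite ltW.
  rewrite exprMn Hsq mul1r expr1n.
  by apply: le_trans (sum_cauchy_schwarz _ _) _; rewrite a1 b1 mulr1.
have sumG j : N.+1%:R / (3 * r.+1%:R) <= \sum_i H i j * G i j.
  apply: (@le_trans _ _ (\sum_i (H i j * G i j) ^+ 2)); last first.
    by apply: ler_sum => i _; exact: G1.
  have := hA (\row_l b j l) _; set S := \sum_i _.
  have -> : S = \sum_i (H i j * G i j) ^+ 2.
    apply: eq_bigr => i _; rewrite exprMn Hsq mul1r.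
    have -> : G i j = (B *m (\row_l b j l)^T) i 0 / Num.sqrt (row_sqr B i).
      rewrite mxE mulr_suml; apply: eq_bigr => l _.
      by rewrite !mxE mulrAC.
    by rewrite expr_div_n sqr_sqrtr ?row_sqr_ge0.
  apply; rewrite mxE -(b1 j); apply: eq_bigr => l _.
  by rewrite !mxE expr2.
(* The inner product of [c j] with the unit vector [b j] is the column sum, so [c j] is long; but
   the rows of [H] are orthogonal, which fixes the sum of the squared lengths. *)
pose c j l := \sum_i H i j * a i l.
have cE j : \sum_l c j l * b j l = \sum_i H i j * G i j.
  under eq_bigr do rewrite mulr_suml.
  rewrite exchange_big; apply: eq_bigr => i _; rewrite mulr_sumr.
  by apply: eq_bigr => l _; rewrite -mulrA.
have c_ge j : (N.+1%:R / (3 * r.+1%:R)) ^+ 2 <= \sum_l c j l ^+ 2.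
  have := sum_cauchy_schwarz (c j) (b j); rewrite b1 mulr1 cE.
  apply: le_trans; rewrite ler_pXn2r ?nnegrE // ?divr_ge0 ?mulr_ge0 //.
  by apply: sumr_ge0 => i _; rewrite ltW.
have c_sum : \sum_j \sum_l c j l ^+ 2 = N.+1%:R * N.+1%:R.
  transitivity (\sum_l \sum_i \sum_i' a i l * a i' l * \sum_j H i j * H i' j).
    rewrite exchange_big; apply: eq_bigr => l _.
    under [RHS]eq_bigr do under eq_bigr do rewrite mulr_sumr.
    under [RHS]eq_bigr do rewrite exchange_big.
    rewrite [RHS]exchange_big; apply: eq_bigr => j _ /=.
    rewrite expr2 big_distrlr /=.
    by apply: eq_bigr => i _; apply: eq_bigr => i' _; rewrite mulrACA mulrC.
  transitivity (\sum_l \sum_i N.+1%:R * a i l ^+ 2).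
    apply: eq_bigr => l _; apply: eq_bigr => i _.
    under eq_bigr do rewrite Horth.
    rewrite (bigD1 i) //= big1 ?addr0 => [|i' /negPf ne].
      by rewrite eqxx mulr1 mulrC expr2.
    by rewrite eq_sym ne !mulr0.
  rewrite exchange_big /=; under eq_bigr do rewrite -mulr_sumr a1 mulr1.
  by rewrite sumr_const card_ord mulr_natr.
have : N.+1%:R * (N.+1%:R / (3 * r.+1%:R)) ^+ 2 <= N.+1%:R * N.+1%:R :> R.
  rewrite -c_sum mulr_natl -[X in _ *+ X]card_ord -sumr_const.
  by apply: ler_sum => j _; exact: c_ge.
rewrite ler_pM2l ?ltr0n // expr_div_n ler_pdivrMr ?exprn_gt0 ?mulr_gt0 ?ltr0n //.
rewrite expr2 ler_pM2l ?ltr0n // exprMn -!natrX -natrM ler_nat.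
by [].
Qed.

(** * Layered diagrams have low rank across a cut *)

(** Edge indicators as weights count nondeterministic paths and transition probabilities give
    [reach_prob], so both models share one rank argument. *)
Fixpoint reach_weight (R : realFieldType) (n k : nat)
    (G : leveled_graph (k * n)) (pi : {perm 'I_n}) (wt : bool -> G -> G -> R)
    (s : n.-tuple bool) (t : nat) (v : G) : R :=
  if t is t'.+1 then
    \sum_u reach_weight pi wt s t' u * wt (tested_bit pi s (level u)) u v
  else (v == source G)%:R.

Definition level_weights (R : realFieldType) (h : nat) (G : leveled_graph h)
    (wt : bool -> G -> G -> R) :=
  (forall b u v, 0 <= wt b u v) /\
  (forall b u v, wt b u v != 0 -> level v = (level u).+1 :> nat).

Lemma reach_weight_ge0 (R : realFieldType) (n k : nat)
    (G : leveled_graph (k * n)) (pi : {perm 'I_n}) (wt : bool -> G -> G -> R) s t v :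
  level_weights wt -> 0 <= reach_weight pi wt s t v.
Proof.
move=> [wt0 _]; elim: t v => [|t IH] v /=; first exact: ler0n.
by apply: sumr_ge0 => u _; rewrite mulr_ge0.
Qed.

Lemma reach_weight_level (R : realFieldType) (n k : nat)
    (G : leveled_graph (k * n)) (pi : {perm 'I_n}) (wt : bool -> G -> G -> R) s t v :
  level_weights wt -> reach_weight pi wt s t v != 0 -> level v = t :> nat.
Proof.
move=> [_ wtl]; elim: t v => [|t IH] v /=.
  by case: (v =P source G) => [-> _|_]; rewrite ?level_source ?eqxx.
have [/existsP[u]|] := boolP [exists u, reach_weight pi wt s t u *
                              wt (tested_bit pi s (level u)) u v != 0].
  by rewrite mulf_eq0 negb_or => /andP[/IH <- /wtl ->].
rewrite negb_exists => /forallP h0; rewrite big1 ?eqxx // => u _.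
exact/eqP/negPn/h0.
Qed.

(** Weight at time [t] sits on level [t] only, so the tested bit can be read off from the time
    instead of the node. *)
Lemma reach_weightS (R : realFieldType) (n k : nat)
    (G : leveled_graph (k * n)) (pi : {perm 'I_n}) (wt : bool -> G -> G -> R) s t v :
  level_weights wt ->
  reach_weight pi wt s t.+1 v =
  \sum_u reach_weight pi wt s t u * wt (tested_bit pi s t) u v.
Proof.
move=> hwt /=; apply: eq_bigr => u _.
by have [->|/(reach_weight_level hwt) ->//] := eqVneq (reach_weight pi wt s t u) 0;
  rewrite !mul0r.
Qed.

Lemma card_level_le_width (h : nat) (G : leveled_graph h) (t : nat) :
  (t <= h)%N -> (#|[set v : G | level v == t :> nat]| <= width G)%N.
Proof.
move=> th; rewrite /width (bigD1 (inord t)) //= leq_max; apply/orP; left.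
apply: subset_leq_card; apply/subsetP => v; rewrite !inE => /eqP e.
by apply/eqP/val_inj; rewrite /= inordK.
Qed.

(* A nonnegative rank-[d] decomposition in which only the [x]-factors may
   depend on [v]. *)
Definition split_rank (R : realFieldType) (X Y V : Type) (d : nat)
    (phi : X -> Y -> V -> R) : Prop :=
  exists (I : finType) (a : X -> I -> V -> R) (b : Y -> I -> R),
    [/\ (#|I| <= d)%N, forall x i v, 0 <= a x i v, forall y i, 0 <= b y i &
        forall x y v, phi x y v = \sum_i a x i v * b y i].

Lemma split_rank_step (R : realFieldType) (X Y : Type) (V : finType) (d : nat)
    (phi psi : X -> Y -> V -> R) (T : X -> V -> V -> R) :
  (forall x u v, 0 <= T x u v) ->
  (forall x y v, psi x y v = \sum_u phi x y u * T x u v) ->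
  split_rank d phi -> split_rank d psi.
Proof.
move=> T0 psiE [I [a [b [dI a0 b0 phiE]]]].
exists I, (fun x i v => \sum_u a x i u * T x u v), b; split=> // [x i v|x y v].
  by apply: sumr_ge0 => u _; rewrite mulr_ge0.
rewrite psiE; under [RHS]eq_bigr do rewrite mulr_suml.
rewrite [RHS]exchange_big; apply: eq_bigr => u _ /=.
by rewrite phiE mulr_suml; apply: eq_bigr => i _; rewrite mulrAC.
Qed.

(** Making the current node part of the index multiplies the rank by at most [W] and hands the node
    over to the other side, like a message in a protocol. *)
Lemma split_rank_swap (R : realFieldType) (X Y : Type) (V : finType)
    (d W : nat) (S : {set V}) (phi : X -> Y -> V -> R) :
  (#|S| <= W)%N -> (forall x y v, phi x y v != 0 -> v \in S) ->
  split_rank d phi -> split_rank (d * W) (fun y x v => phi x y v).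
Proof.
move=> SW suppS [I [a [b [dI a0 b0 phiE]]]].
exists (I * {v | v \in S})%type.
exists (fun y p v => b y p.1 * (v == val p.2)%:R), (fun x p => a x p.1 (val p.2)).
split=> // [|y p v|y x v].
- by rewrite card_prod card_sig leq_mul.
- by rewrite mulr_ge0.
rewrite -(pair_bigA _ (fun i u => b y i * (v == val u)%:R * a x i (val u))) /=.
have [vS|vS] := boolP (v \in S).
  rewrite phiE; apply: eq_bigr => i _; rewrite (bigD1 (exist _ v vS)) //=.
  rewrite eqxx mulr1 mulrC big1 ?addr0 // => u ne.
  case: eqP => [e|_]; last by rewrite mulr0 mul0r.
  by case/eqP: ne; apply: val_inj.
have -> : phi x y v = 0 by apply/eqP; apply: contraNT vS; exact: suppS.
rewrite big1 // => i _; rewrite big1 // => u _.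
case: eqP => [e|_]; last by rewrite mulr0 mul0r.
by move: vS; rewrite e (valP u).
Qed.

Lemma tested_bitE (n : nat) (pi : {perm 'I_n}) s i (p : 'I_n) :
  tested_bit pi s (i * n + p) = tnth s (pi p).
Proof.
rewrite /tested_bit modnMDl modn_small // (nth_map p) ?size_enum_ord //.
by rewrite nth_ord_enum.
Qed.

Lemma split_rank_steps (R : realFieldType) (n k : nat)
    (G : leveled_graph (k * n)) (pi : {perm 'I_n}) (wt : bool -> G -> G -> R)
    (X Y : Type) (s : X -> Y -> n.-tuple bool) (y0 : Y) (d t j : nat) :
  level_weights wt ->
  (forall q, (q < j)%N -> forall x y y',
     tested_bit pi (s x y) (t + q) = tested_bit pi (s x y') (t + q)) ->
  split_rank d (fun x y => reach_weight pi wt (s x y) t) ->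
  split_rank d (fun x y => reach_weight pi wt (s x y) (t + j)).
Proof.
move=> hwt; elim: j => [|j IH] hs h0; first by rewrite addn0.
have {}IH := IH (fun q qj => hs q (ltnW qj)) h0; rewrite addnS.
apply: split_rank_step IH => [x u v|x y v].
  exact: (hwt.1 (tested_bit pi (s x y0) (t + j)) u v).
by rewrite reach_weightS // (hs j _ x y y0).
Qed.

(** Before the cut only [x] is read, then the node is handed over, and the rest of the layer reads
    only [y]; hence the exchanged roles in the conclusion. *)
Lemma split_rank_pass (R : realFieldType) (n k : nat)
    (G : leveled_graph (k * n)) (pi : {perm 'I_n}) (wt : bool -> G -> G -> R)
    (X Y : Type) (s : X -> Y -> n.-tuple bool) (x0 : X) (y0 : Y) (l d i : nat) :
  level_weights wt -> (l <= n)%N -> (i < k)%N ->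
  (forall p : 'I_n, (p < l)%N -> forall x y y',
     tnth (s x y) (pi p) = tnth (s x y') (pi p)) ->
  (forall p : 'I_n, (l <= p)%N -> forall x x' y,
     tnth (s x y) (pi p) = tnth (s x' y) (pi p)) ->
  split_rank d (fun x y => reach_weight pi wt (s x y) (i * n)) ->
  split_rank (d * width G)
    (fun y x => reach_weight pi wt (s x y) (i.+1 * n)).
Proof.
move=> hwt ln ik hL hR h.
have {}h : split_rank d (fun x y => reach_weight pi wt (s x y) (i * n + l)).
  apply: split_rank_steps h => // q ql x y y'.
  by have qn := leq_trans ql ln; rewrite !(tested_bitE _ _ _ (Ordinal qn)) (hL _ _ x y y').
have tk : (i * n + l <= k * n)%N by nia.
have {}h : split_rank (d * width G)
    (fun y x => reach_weight pi wt (s x y) (i * n + l)).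
  apply: split_rank_swap (card_level_le_width G tk) _ h => x y v.
  by move/(reach_weight_level hwt) => e; rewrite inE e.
have -> : (i.+1 * n = i * n + l + (n - l))%N by rewrite mulSn; lia.
apply: (@split_rank_steps _ _ _ _ _ _ Y X (fun y x => s x y)) h => // q ql y x x'.
have qn : (l + q < n)%N by lia.
by rewrite -addnA !(tested_bitE _ _ _ (Ordinal qn)) (hR _ _ x x') //= leq_addr.
Qed.

(** The node is handed over once inside each of the [k.+1] layers and once at each of the [k]
    boundaries between them, starting from rank 1 at the source. *)
Lemma accept_weight_split (R : realFieldType) (n k : nat)
    (G : leveled_graph (k.+1 * n)) (pi : {perm 'I_n}) (wt : bool -> G -> G -> R)
    (X Y : Type) (s : X -> Y -> n.-tuple bool) (x0 : X) (y0 : Y) (l : nat) :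
  level_weights wt -> (l <= n)%N ->
  (forall p : 'I_n, (p < l)%N -> forall x y y',
     tnth (s x y) (pi p) = tnth (s x y') (pi p)) ->
  (forall p : 'I_n, (l <= p)%N -> forall x x' y,
     tnth (s x y) (pi p) = tnth (s x' y) (pi p)) ->
  exists (I : finType) (a : X -> I -> R) (b : Y -> I -> R),
    [/\ (#|I| <= width G ^ (k.*2.+1))%N, forall x i, 0 <= a x i,
        forall y i, 0 <= b y i &
        forall x y, \sum_(v in accepting G)
          reach_weight pi wt (s x y) (k.+1 * n) v = \sum_i a x i * b y i].
Proof.
move=> hwt ln hL hR.
have main i : (i <= k)%N -> split_rank (width G ^ i.*2)
    (fun x y => reach_weight pi wt (s x y) (i * n)).
  elim: i => [_|i IH ik].
    exists unit, (fun _ _ v => (v == source G)%:R), (fun _ _ => 1).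
    split=> [|x i v|y i|x y v]; rewrite ?card_unit ?ler0n ?ler01 //.
    by rewrite (big_pred1 tt) ?mulr1 // => -[].
  have h := split_rank_pass x0 y0 hwt ln (ltnW ik) hL hR (IH (ltnW ik)).
  have tk : (i.+1 * n <= k.+1 * n)%N by rewrite leq_mul2r ltnW ?orbT.
  rewrite doubleS !expnSr.
  apply: split_rank_swap (card_level_le_width G tk) _ h => y x v.
  by move/(reach_weight_level hwt) => e; rewrite inE e.
have := split_rank_pass x0 y0 hwt ln (leqnn _) hL hR (main k (leqnn k)).
rewrite -expnSr => -[I [b [a [dI b0 a0 E]]]].
exists I, a, (fun y i => \sum_(v in accepting G) b y i v).
split=> // [y i|x y]; first by apply: sumr_ge0.
under eq_bigr do rewrite E.
rewrite exchange_big; apply: eq_bigr => i _ /=.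
by rewrite -mulr_suml mulrC.
Qed.

(** * Acceptance expressed by path weights *)

Lemma level_last_path (n k : nat) (P : knobdd n k) s (u : P) p :
  path (consistent s) u p -> level (last u p) = (level u + size p)%N :> nat.
Proof.
elim: p u => [|v p IH] u /=; first by rewrite addn0.
by case/andP => /nobdd_edge_level e /IH ->; rewrite e addSnnS.
Qed.

Definition edge_weight (R : realFieldType) (n k : nat) (P : knobdd n k) :
    bool -> P -> P -> R :=
  fun b u v => (nobdd_edge b u v)%:R.

Lemma edge_level_weights (R : realFieldType) (n k : nat) (P : knobdd n k) :
  level_weights (@edge_weight R n k P).
Proof.
split=> b u v; first exact: ler0n.
rewrite /edge_weight; case: (boolP (nobdd_edge b u v)) => [/nobdd_edge_level //|].
by rewrite eqxx.
Qed.

Lemma reach_weight_gt0P (R : realFieldType) (n k : nat) (P : knobdd n k) s t v :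
  (exists p : seq P, [/\ path (consistent s) (source P) p, size p = t &
                         last (source P) p = v]) <->
  0 < reach_weight (nobdd_order P) (@edge_weight R n k P) s t v.
Proof.
have hwt := edge_level_weights R P.
elim: t v => [|t IH] v /=; split.
- by case=> -[|a p] [] //= _ _ <-; rewrite eqxx ltr01.
- by case: eqP => [->|_]; rewrite ?ltxx // => _; exists [::].
- case=> p0; case/lastP: p0 => [[]//|p v'] [].
  rewrite rcons_path size_rcons last_rcons => /andP[hp e] [sp] <-.
  rewrite (bigD1 (last (source P) p)) //=; apply: ltr_pwDl.
    by rewrite /edge_weight [nobdd_edge _ _ _]e mulr1; apply/IH; exists p.
  by apply: sumr_ge0 => u _; rewrite mulr_ge0 ?reach_weight_ge0 ?hwt.1.
rewrite lt0r => /andP[h _].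
have [/existsP[u]|] := boolP [exists u,
    reach_weight (nobdd_order P) (@edge_weight R n k P) s t u *
    edge_weight R (tested_bit (nobdd_order P) s (level u)) u v != 0].
  rewrite mulf_eq0 negb_or => /andP[h1 h2].
  have /IH[p [hp sp lp]] :
      0 < reach_weight (nobdd_order P) (@edge_weight R n k P) s t u.
    by rewrite lt0r h1 reach_weight_ge0.
  exists (rcons p v); rewrite rcons_path size_rcons last_rcons hp sp lp; split=> //=.
  by apply: contraNT h2; rewrite /edge_weight /consistent => /negPf ->.
rewrite negb_exists => /forallP h0; case/eqP: h; rewrite big1 // => u _.
exact/eqP/negPn/h0.
Qed.

Lemma accepts_weightP (R : realFieldType) (n k : nat) (P : knobdd n k) s :
  accepts P s <->
  0 < \sum_(v in accepting P)
        reach_weight (nobdd_order P) (@edge_weight R n k P) s (k * n) v.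
Proof.
have hwt := edge_level_weights R P; split=> [[p [hp ap]]|].
  rewrite (bigD1 (last (source P) p)) //=; apply: ltr_pwDl.
    apply/reach_weight_gt0P; exists p; split=> //.
    have := level_last_path hp.
    by rewrite level_source add0n => <-; rewrite (level_accepting ap).
  by apply: sumr_ge0 => u _; rewrite reach_weight_ge0.
rewrite lt0r => /andP[h _].
have [/exists_inP[v av]|] := boolP [exists v in accepting P,
    reach_weight (nobdd_order P) (@edge_weight R n k P) s (k * n) v != 0].
  move=> h1; have /reach_weight_gt0P[p [hp _ lp]] :
      0 < reach_weight (nobdd_order P) (@edge_weight R n k P) s (k * n) v.
    by rewrite lt0r h1 reach_weight_ge0.
  by exists p; rewrite lp.
rewrite negb_exists_in => /forall_inP h0; case/eqP: h; rewrite big1 // => v av.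
exact/eqP/negPn/h0.
Qed.

Lemma prob_level_weights (R : realType) (n k : nat) (P : kpobdd R n k) :
  level_weights (@pobdd_prob R n k P).
Proof. by split; [exact: pobdd_prob_ge0 | exact: pobdd_prob_level]. Qed.

Lemma reach_probE (R : realType) (n k : nat) (P : kpobdd R n k) s t v :
  reach_prob s t v = reach_weight (pobdd_order P) (@pobdd_prob R n k P) s t v.
Proof. by elim: t v => //= t IH v; apply: eq_bigr => u _; rewrite IH. Qed.

(** * The Hadamard problem and the width bounds *)

(* [(-1) ^+ quad u v] is a 4 x 4 Hadamard matrix, so [(-1) ^+ had x y] is a
   Hadamard matrix of order [4 ^ #|E|]. *)
Definition quad (u v : bool * bool) : bool :=
  (u.1 (+) v.1) && (u.2 (+) v.2).

Definition had (E : finType) (x y : {ffun E -> bool * bool}) : bool :=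
  \big[addb/false]_e quad (x e) (y e).

Lemma had_sign (R : realFieldType) (E : finType) (x y : {ffun E -> bool * bool}) :
  (-1) ^+ had x y = \prod_e (-1) ^+ quad (x e) (y e) :> R.
Proof.
by apply: (big_morph (fun b : bool => (-1) ^+ b : R)) => // a b; rewrite signr_addb.
Qed.

Lemma sum_bool2 (V : nmodType) (F : bool * bool -> V) :
  \sum_v F v = F (true, true) + F (true, false) +
              (F (false, true) + F (false, false)).
Proof.
rewrite (eq_bigr (fun v => F (v.1, v.2))) => [|[]//].
by rewrite -(pair_bigA _ (fun a b => F (a, b))) /= big_bool /= !big_bool.
Qed.

(** The sum over all functions [y] factors into a sum over four values per coordinate, and a
    coordinate where [x] and [x'] differ contributes 0. *)
Lemma had_orthogonal (R : realFieldType) (E : finType)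
    (x x' : {ffun E -> bool * bool}) :
  \sum_y (-1) ^+ had x y * (-1) ^+ had x' y =
  #|{ffun E -> bool * bool}|%:R * (x == x')%:R :> R.
Proof.
under eq_bigr do rewrite !had_sign -big_split /=.
rewrite -(bigA_distr_bigA (fun e v => (-1) ^+ quad (x e) v * (-1) ^+ quad (x' e) v)).
have quad_orth (u u' : bool * bool) :
    \sum_v (-1) ^+ quad u v * (-1) ^+ quad u' v = 4 * (u == u')%:R :> R.
  rewrite sum_bool2.
  by case: u u' => [[] []] [[] []]; rewrite /quad /= ?expr0 ?expr1; ring.
under eq_bigr do rewrite quad_orth.
rewrite big_split prodr_const card_ffun card_prod card_bool natrX /=; congr (_ * _).
have [->|/eqP ne] := eqVneq x x'; first by rewrite big1 // => e _; rewrite eqxx.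
have [/existsP[e he]|] := boolP [exists e, x e != x' e].
  by rewrite (bigD1 e) //= (negPf he) mul0r.
by rewrite negb_exists => /forallP h; case: ne; apply/ffunP => e; apply/eqP/negPn.
Qed.

Lemma hadC (E : finType) (x y : {ffun E -> bool * bool}) : had x y = had y x.
Proof. by apply: eq_bigr => e _; rewrite /quad addbC [in X in _ && X]addbC. Qed.

Lemma had_row_sum (R : realFieldType) (E : finType)
    (x : {ffun E -> bool * bool}) :
  \sum_y (-1) ^+ had x y = 2 ^+ #|E| :> R.
Proof.
under eq_bigr do rewrite had_sign.
rewrite -(bigA_distr_bigA (fun e v => (-1) ^+ quad (x e) v)) -prodr_const.
apply: eq_bigr => e _; rewrite sum_bool2.
by case: (x e) => [[] []]; rewrite /quad /= ?expr0 ?expr1; ring.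
Qed.

(** Lindsey's lemma. By orthogonality the signed row sums [c x] over [B] have total square
    [M * #|B|], with [M] the order of the matrix; they equal [- #|B|] on [A], and Cauchy-Schwarz
    over [A] concludes. *)
Lemma had_rectangle (E : finType) (A B : {pred {ffun E -> bool * bool}}) :
  (forall x y, x \in A -> y \in B -> had x y) ->
  (#|A| * #|B| <= #|{ffun E -> bool * bool}|)%N.
Proof.
move=> hAB; pose c (x : {ffun E -> bool * bool}) : rat := \sum_(y in B) (-1) ^+ had x y.
have cA x : x \in A -> c x = - #|B|%:R.
  move=> xA; rewrite /c (eq_bigr (fun=> -1)) => [|y yB].
    by rewrite sumr_const mulNrn.
  by rewrite hAB.
have c2 : \sum_x c x ^+ 2 = #|{ffun E -> bool * bool}|%:R * #|B|%:R.
  under eq_bigr do rewrite expr2 big_distrlr /=.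
  rewrite exchange_big /= -[#|B|]sum1_card natr_sum mulr_sumr; apply: eq_bigr => y yB.
  rewrite exchange_big; under eq_bigr => y' _.
    under eq_bigr => x _ do rewrite (hadC x y) (hadC x y').
    rewrite had_orthogonal.
    over.
  rewrite (bigD1 y) //= eqxx big1 ?addr0 // => y' /andP[_ /negPf ne].
  by rewrite eq_sym ne mulr0.
have := sqr_sum_le A c; rewrite c2 (eq_bigr (fun=> - #|B|%:R)) //.
rewrite sumr_const mulNrn sqrrN -mulrnA -!natrM -natrX ler_nat.
set M := #|{ffun _}|; have -> : (#|A| * (M * #|B|) = #|A| * #|B| * M)%N by lia.
rewrite [(#|B| * _)%N]mulnC -mulnn; have [->//|AB0] := posnP (#|A| * #|B|)%N.
by rewrite leq_pmul2l.
Qed.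

(* Under the cut [l] of the order [pi], the inputs [s x y] realise the
   communication problem [had]: the variables tested before the cut depend on
   [x] only, the others on [y] only. *)
Definition embeds_had (n : nat) (f : n.-tuple bool -> bool)
    (pi : {perm 'I_n}) (E : finType) : Prop :=
  exists (l : nat)
    (s : {ffun E -> bool * bool} -> {ffun E -> bool * bool} -> n.-tuple bool),
  [/\ (l <= n)%N,
      forall p : 'I_n, (p < l)%N -> forall x y y',
        tnth (s x y) (pi p) = tnth (s x y') (pi p),
      forall p : 'I_n, (l <= p)%N -> forall x x' y,
        tnth (s x y) (pi p) = tnth (s x' y) (pi p) &
      forall x y, f (s x y) = had x y].

(** The supports of the nonnegative factors cover the ones of [had] by at most [width P ^ k.*2.+1]
    rectangles of size at most [4 ^ #|E|], while the ones fill at least a quarter of the matrix. *)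
Lemma knobdd_width_ge (n k : nat) (P : knobdd n k.+1)
    (f : n.-tuple bool -> bool) (E : finType) :
  (0 < #|E|)%N -> (forall s, f s <-> accepts P s) ->
  embeds_had f (nobdd_order P) E ->
  (4 ^ #|E| <= 4 * width P ^ k.*2.+1)%N.
Proof.
move=> E0 hf [l [s [ln hL hR fs]]].
pose X := {ffun E -> bool * bool}.
have cX : #|{: X}| = (4 ^ #|E|)%N by rewrite card_ffun card_prod card_bool.
pose x0 : X := [ffun=> (true, true)].
have [I [a [b [dI a0 b0 E']]]] :=
  accept_weight_split x0 x0 (edge_level_weights rat P) ln hL hR.
pose A i := [pred x | a x i != 0]; pose B i := [pred y | b y i != 0].
have hadE x y : had x y <-> exists i, x \in A i /\ y \in B i.
  rewrite -fs; split=> [/hf/(accepts_weightP rat)|[i [xA yB]]].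
    rewrite E' lt0r => /andP[h _].
    have [/existsP[i]|] := boolP [exists i, a x i * b y i != 0].
      by rewrite mulf_eq0 negb_or => /andP[? ?]; exists i.
    rewrite negb_exists => /forallP h0; case/eqP: h; rewrite big1 // => i _.
    exact/eqP/negPn/h0.
  apply/hf/(accepts_weightP rat); rewrite E' (bigD1 i) //=; apply: ltr_pwDl.
    by rewrite lt0r mulf_neq0 //= mulr_ge0.
  by apply: sumr_ge0 => j _; rewrite mulr_ge0.
have rect i : (#|A i| * #|B i| <= 4 ^ #|E|)%N.
  by rewrite -cX; apply: had_rectangle => x y xA yB; apply/hadE; exists i.
have le_rect : (\sum_(x : X) \sum_(y : X) had x y <=
                \sum_i #|A i| * #|B i|)%N.
  have -> : (\sum_i #|A i| * #|B i| =
             \sum_(x : X) \sum_(y : X) \sum_i (x \in A i) * (y \in B i))%N.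
    under [RHS]eq_bigr do rewrite exchange_big.
    rewrite [RHS]exchange_big; apply: eq_bigr => i _ /=.
    rewrite -big_distrlr /=; congr (_ * _)%N;
      by rewrite -sum1_card big_mkcond; apply: eq_bigr => x _; case: (x \in _).
  apply: leq_sum => x _; apply: leq_sum => y _.
  case h : (had x y) => //; have /hadE[i [xA yB]] := h.
  by rewrite (bigD1 i) //= xA yB.
(* A row has [(4 ^ #|E| - 2 ^ #|E|) / 2] ones, at least a quarter of it because [2 <= 2 ^ #|E|]. *)
have ge_sum (x : X) : (4 ^ #|E| <= 4 * \sum_(y : X) had x y)%N.
  have : \sum_(y : X) ((-1) ^+ had x y + (2 * had x y)%:R) = (4 ^ #|E|)%:R :> rat.
    rewrite -cX -sum1_card natr_sum; apply: eq_bigr => y _.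
    by case: (had x y) => //=; rewrite expr1 addNKr.
  rewrite big_split had_row_sum /= -natr_sum -natrX -natrD => /eqP.
  rewrite eqr_nat -big_distrr /= => /eqP.
  have -> : (4 ^ #|E| = 2 ^ #|E| * 2 ^ #|E|)%N by rewrite -expnMn.
  have : (2 ^ 1 <= 2 ^ #|E|)%N by rewrite leq_exp2l.
  by set S := (\sum_y _)%N; set q := (2 ^ #|E|)%N; nia.
have : (4 ^ #|E| * 4 ^ #|E| <= 4 * (#|I| * 4 ^ #|E|))%N.
  apply: (@leq_trans (4 * \sum_(x : X) \sum_(y : X) had x y)%N).
    rewrite -{1}cX -sum_nat_const big_distrr.
    by apply: leq_sum => x _; exact: ge_sum.
  rewrite leq_mul2l /=; apply: leq_trans le_rect _.
  by rewrite -sum_nat_const; apply: leq_sum => i _; exact: rect.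
rewrite mulnA leq_pmul2r ?expn_gt0 // => /leq_trans; apply.
by rewrite leq_mul2l.
Qed.

(** The matrix of [1 / 2] minus the acceptance probability has the signs of [(-1) ^+ had]. It
    factors through [#|I| + 1] indices, the index [None] carrying the constant [1 / 2]. *)
Lemma kpobdd_width_ge (R : realType) (n k : nat) (P : kpobdd R n k.+1)
    (f : n.-tuple bool -> bool) (E : finType) :
  bounded_error P f -> embeds_had f (pobdd_order P) E ->
  (4 ^ #|E| <= 9 * (width P ^ k.*2.+1).+1 ^ 2)%N.
Proof.
move=> [e e0 hf] [l [s [ln hL hR fs]]].
pose X := {ffun E -> bool * bool}.
have cX : #|{: X}| = (4 ^ #|E|)%N by rewrite card_ffun card_prod card_bool.
pose x0 : X := [ffun=> (true, true)].
have [I [a [b [dI a0 b0 E']]]] :=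
  accept_weight_split x0 x0 (prob_level_weights P) ln hL hR.
have accE x y : accept_prob P (s x y) = \sum_i a x i * b y i.
  by rewrite -E'; apply: eq_bigr => v _; rewrite reach_probE.
case: {2}#|{: X}| (erefl #|{: X}|) => [|N] cN.
  by move: (expn_gt0 4 #|E|); rewrite -cX cN.
pose xi (i : 'I_N.+1) : X := enum_val (cast_ord (esym cN) i).
have xi_inj : injective xi by move=> i j /enum_val_inj /cast_ord_inj.
have xi_bij : bijective xi by apply: inj_card_bij => //; rewrite card_ord cN.
pose H : 'M[R]_N.+1 := \matrix_(i, j) (-1) ^+ had (xi i) (xi j).
pose aI x (o : option I) : R := if o is Some i then - a x i else 1 / 2.
pose bI y (o : option I) : R := if o is Some i then b y i else 1.
pose U : 'M[R]_(N.+1, #|{: option I}|) := \matrix_(i, t) aI (xi i) (enum_val t).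
pose V : 'M[R]_(#|{: option I}|, N.+1) := \matrix_(t, j) bI (xi j) (enum_val t).
have UV i j : (U *m V) i j = 1 / 2 - accept_prob P (s (xi i) (xi j)).
  rewrite mxE accE.
  transitivity (\sum_o aI (xi i) o * bI (xi j) o).
    rewrite (reindex (fun t : 'I_#|{: option I}| => enum_val t)) /=; last exact/onW_bij/enum_val_bij.
    by apply: eq_bigr => t _; rewrite !mxE.
  rewrite (bigD1 None) //= mulr1 -sumrN; congr (_ + _).
  rewrite (reindex_omap Some id) => [|[]//].
  by apply: eq_big => t; rewrite ?eqxx // mulNr.
rewrite -cX cN; apply: leq_trans (sign_rank_hadamard (H := H) (U := U) (V := V) _ _ _) _.
- by move=> i j; rewrite mxE sqrr_sign.
- move=> i i'; under eq_bigr do rewrite !mxE.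
  have := had_orthogonal R (xi i) (xi i'); rewrite cN (inj_eq xi_inj) => <-.
  by rewrite [RHS](reindex xi) //; exact: onW_bij.
- move=> i j; rewrite UV mxE -fs; have := hf (s (xi i) (xi j)).
  by case: (f _) => h; rewrite ?expr0 ?expr1; lra.
by rewrite leq_mul2l leq_exp2r //= card_option ltnS.
Qed.

(** * Automata as deterministic diagrams *)

Lemma tested_bit_id (n : nat) (s : n.-tuple bool) t :
  tested_bit 1%g s t = nth false s (t %% n).
Proof.
by rewrite /tested_bit; under eq_map do rewrite perm1; rewrite map_tnth_enum.
Qed.

Definition run (S : Type) (step : nat -> S -> bool -> S) (bit : nat -> bool)
    (t0 len : nat) (st : S) : S :=
  foldl (fun st t => step t st (bit t)) st (iota t0 len).

Lemma run_cat (S : Type) (step : nat -> S -> bool -> S) bit t0 l1 l2 st :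
  run step bit t0 (l1 + l2) st =
  run step bit (t0 + l1) l2 (run step bit t0 l1 st).
Proof. by rewrite /run iotaD foldl_cat. Qed.

Lemma run_succ (S : Type) (step : nat -> S -> bool -> S) bit t0 l st :
  run step bit t0 l.+1 st =
  step (t0 + l)%N (run step bit t0 l st) (bit (t0 + l)%N).
Proof. by rewrite -addn1 run_cat. Qed.

Definition automaton_fun (n k : nat) (S : Type) (step : nat -> S -> bool -> S)
    (st0 : S) (acc : pred S) (s : n.-tuple bool) : bool :=
  acc (run step (fun t => nth false s (t %% n)) 0 (k * n) st0).

Section Automaton.

Variables (n k : nat) (S : finType) (step : nat -> S -> bool -> S).
Variables (st0 : S) (acc : pred S).

Local Notation state_at s t :=
  (run step (fun t' => nth false (tval s) (t' %% n)) 0 t st0).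

(** Nodes are all pairs of a time and a state, reachable or not, so that each level is a copy of [S]
    and every inner node has its successor. *)
Definition automaton_graph : leveled_graph (k * n).
Proof.
apply: (@LeveledGraph _ ('I_(k * n).+1 * S)%type fst (ord0, st0)
          [set v | (v.1 == ord_max) && acc v.2]) => // v.
by rewrite inE => /andP[/eqP].
Defined.

Definition automaton_edge (b : bool) (u v : automaton_graph) : bool :=
  (v.1 == u.1.+1 :> nat) && (v.2 == step u.1 u.2 b).

Lemma automaton_edge_level b u v :
  automaton_edge b u v -> level v = (level u).+1 :> nat.
Proof. by case/andP => /eqP. Qed.

Definition automaton : knobdd n k := KNobdd 1%g automaton_edge_level.

Lemma automaton_width : (width automaton <= #|S|)%N.
Proof.
apply/bigmax_leqP => t _.
have -> : [set v : automaton | level v == t] = setX [set t] [set: S].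
  by apply/setP => -[i x]; rewrite !inE andbT.
by rewrite cardsX cards1 cardsT mul1n.
Qed.

Lemma automaton_deterministic : deterministic automaton.
Proof.
move=> u b ub; rewrite -(cards1 ((inord u.1.+1, step u.1 u.2 b) : automaton)).
apply: eq_card => -[i x]; rewrite !inE /automaton_edge /= xpair_eqE.
congr (_ && _); apply/eqP/eqP => [e|->]; last by rewrite inordK.
by apply: val_inj; rewrite /= inordK.
Qed.

Lemma automaton_reach (R : realFieldType) s t v : (t <= k * n)%N ->
  reach_weight 1%g (@edge_weight R n k automaton) s t v =
  ((v.1 == t :> nat) && (v.2 == state_at s t))%:R.
Proof.
elim: t v => [|t IH] v tk /=; first by rewrite -pair_eqE /= -val_eqE.
rewrite -/(reach_weight 1%g (@edge_weight R n k automaton) s t.+1 v).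
rewrite (reach_weightS _ _ _ _ (edge_level_weights R automaton)).
rewrite (bigD1 ((inord t, state_at s t) : automaton)) //= IH ?(ltnW tk) //=.
rewrite inordK ?eqxx ?mul1r; last by rewrite ltnS ltnW.
rewrite big1 ?addr0 => [|u ne].
  rewrite /edge_weight /= /automaton_edge /= inordK; last by rewrite ltnS ltnW.
  by rewrite tested_bit_id run_succ.
rewrite IH ?(ltnW tk) //; case: andP => [[/eqP e1 /eqP e2]|]; last by rewrite mul0r.
case/eqP: ne; rewrite [u]surjective_pairing e2; congr pair.
by apply: val_inj; rewrite /= inordK // ltnS ltnW.
Qed.

Lemma automaton_accept_weight (R : realFieldType) s :
  \sum_(v in accepting automaton)
     reach_weight 1%g (@edge_weight R n k automaton) s (k * n) v =
  (automaton_fun k step st0 acc s)%:R.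
Proof.
under eq_bigr do rewrite automaton_reach //.
rewrite big_mkcond (bigD1 ((ord_max, state_at s (k * n)) : automaton)) //=.
rewrite big1 ?addr0 => [|u ne].
  by rewrite inE !eqxx /automaton_fun; case: (acc _).
case: ifP => // _; case: andP => [[/eqP e1 /eqP e2]|//].
case/eqP: ne; rewrite [u]surjective_pairing e2; congr pair.
exact: val_inj.
Qed.

Lemma automaton_accepts s : automaton_fun k step st0 acc s <-> accepts automaton s.
Proof.
rewrite (accepts_weightP rat) automaton_accept_weight.
by case: (automaton_fun _ _ _ _ _); rewrite ?ltr01 ?ltxx.
Qed.

Lemma automaton_kOBDD (R : realType) (W : R) : #|S|%:R <= W ->
  kOBDD k W (automaton_fun (n := n) k step st0 acc).
Proof.
move=> SW; exists automaton; split; [exact: automaton_deterministic| |].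
  by apply: le_trans SW; rewrite ler_nat automaton_width.
exact: automaton_accepts.
Qed.

Lemma automaton_kPOBDD (R : realType) (W : R) : #|S|%:R <= W ->
  kPOBDD k W (automaton_fun (n := n) k step st0 acc).
Proof.
move=> SW; have [w0 wl] := edge_level_weights R automaton.
have w1 b (u : automaton) : (level u < k * n)%N ->
    \sum_v edge_weight R b u v = 1.
  move=> /(automaton_deterministic b) e.
  transitivity (#|[set v : automaton | nobdd_edge b u v]|%:R : R).
    rewrite -sum1_card natr_sum [RHS]big_mkcond; apply: eq_bigr => v _.
    by rewrite inE /edge_weight; case: nobdd_edge.
  by rewrite e.
pose P := KPobdd 1%g w0 wl w1; exists P; split.
  by apply: le_trans SW; rewrite ler_nat automaton_width.
exists (1 / 2) => [|s]; first by lra.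
have -> : accept_prob P s = (automaton_fun k step st0 acc s)%:R.
  by rewrite -automaton_accept_weight; apply: eq_bigr => v _; rewrite reach_probE.
by case: (automaton_fun _ _ _ _ _) => /=; lra.
Qed.

End Automaton.

(** * Balanced cuts *)

Local Open Scope nat_scope.

(** Ranks are distinct, so raising the cut by one moves at most one item across it and affects at
    most one quarter. *)
Lemma crossing_count_le1 (Q l : nat) (rank : nat -> nat) (a b : nat) :
  (a < b < 4) ->
  (forall e e', (e < 4 * Q) -> (e' < 4 * Q) -> rank e = rank e' -> e = e') ->
  ~~ (has (fun e => rank e == l) (iota (a * Q) Q) &&
      has (fun e => rank e == l) (iota (b * Q) Q)).
Proof.
move=> ab inj; apply/negP => /andP[/hasP[e + /eqP re] /hasP[e' + /eqP re']].
rewrite !mem_iota => he he'.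
have : e = e' by apply: inj; rewrite ?re ?re' //; nia.
by move=> ee; nia.
Qed.

(* For some cut exactly two of the four quarters have at least half of their
   items before the cut; the shift [delta] then pairs cyclically adjacent
   quarters of different colours. *)
Lemma exists_balanced_cut (n K : nat) (rank : nat -> nat) :
  (0 < K) ->
  (forall e, (e < 4 * (2 * K)) -> (rank e < n)) ->
  (forall e e', (e < 4 * (2 * K)) -> (e' < 4 * (2 * K)) ->
     rank e = rank e' -> e = e') ->
  exists (l : nat) (col : nat -> bool) (delta : bool),
    [/\ (l <= n),
        forall u, ~~ odd (u + delta) -> col (u %% 4) = ~~ col (u.+1 %% 4) &
        forall a, (a < 4) ->
          (K <= count (fun e => (rank e < l) == col a)
                  (iota (a * (2 * K)) (2 * K)))].
Proof.
set Q := (2 * K) => K0 rank_n rank_inj.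
pose maj l a := (K <= count (fun e => rank e < l) (iota (a * Q) Q)).
pose g l := (maj l 0 + maj l 1 + maj l 2 + maj l 3).
have maj0 a : maj 0%N a = false.
  by rewrite /maj (eq_count (a2 := pred0)) // count_pred0 leqn0 eqn0Ngt K0.
have majn a : (a < 4) -> maj n a.
  move=> a4; rewrite /maj (eq_in_count (a2 := predT)) => [|e].
    by rewrite count_predT size_iota /Q; lia.
  by rewrite mem_iota => he; rewrite rank_n //; nia.
(* At the least such cut the count is exactly 2, because it grows by at most 1 per step. *)
have exg : exists l, (2 <= g l) by exists n; rewrite /g !majn.
have ln : (ex_minn exg <= n).
  by case: ex_minnP => l _; apply; rewrite /g !majn.
move: ln; case: ex_minnP => -[|l] gl minl ln; first by move: gl; rewrite /g !maj0.
have gl' : (g l <= 1) by rewrite leqNgt; apply/negP => /minl; rewrite ltnn.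
pose c a := has (fun e => rank e == l) (iota (a * Q) Q).
have majS a : (maj l.+1 a <= maj l a + c a).
  rewrite /c; case: (boolP (has _ _)) => [_|/hasPn h].
    by case: (maj l.+1 a); rewrite // addn1.
  rewrite addn0 /maj (_ : count _ _ = count (fun e => (rank e < l)) (iota (a * Q) Q)) //.
  by apply: eq_in_count => e /h ne; rewrite ltnS leq_eqVlt (negPf ne).
have cc a b : (a < b < 4) -> ~~ (c a && c b).
  by move=> ab; exact: crossing_count_le1.
have c1 : (c 0 + c 1 + c 2 + c 3 <= 1).
  move: (cc 0 1 isT) (cc 0 2 isT) (cc 0 3 isT) (cc 1 2 isT) (cc 1 3 isT) (cc 2 3 isT).
  by case: (c 0); case: (c 1); case: (c 2); case: (c 3).
have g2 : g l.+1 = 2.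
  move: (majS 0) (majS 1) (majS 2) (majS 3) gl gl'; rewrite /g.
  by move: c1; lia.
(* If quarters 0 and 1 differ in colour, the pairs are 0-1 and 2-3; otherwise they are 1-2 and
   3-0. *)
exists l.+1, (maj l.+1), (maj l.+1 0 == maj l.+1 1); split=> // [u|a a4].
  have [q [r [ru r4]]] : exists q r, u = (q * 4 + r) /\ (r < 4).
    by exists (u %/ 4), (u %% 4); rewrite -divn_eq ltn_pmod.
  rewrite ru -addnS !modnMDl oddD oddD oddM /= andbF addFb.
  by move: g2; rewrite /g; case: r r4 {ru} => [|[|[|[|//]]]] _ /=;
    case: (maj l.+1 0); case: (maj l.+1 1); case: (maj l.+1 2); case: (maj l.+1 3).
rewrite -/(maj l.+1 a); case h : (maj l.+1 a).
  by rewrite (eq_count (a2 := fun e => (rank e < l.+1))) // => e; rewrite eqb_id.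
pose A := [pred e | rank e < l.+1].
have := count_predC A (iota (a * Q) Q); rewrite size_iota.
rewrite [in X in _ -> X](@eq_count _ _ (predC A)) => [|e]; last by rewrite /= eqbF_neg.
have : count A (iota (a * Q) Q) < K by rewrite ltnNge; move/negbT: h.
by rewrite /Q; lia.
Qed.

(** In each stretch of [Q] items the successive good items are given the successive elements of
    [ws], all others [None]. Each element then has exactly one owner per stretch, stated as a parity
    for use inside xor sums. *)
Lemma exists_owner (T : eqType) (ws : seq T) (Q m : nat) (good : pred nat) :
  0 < Q -> uniq ws ->
  (forall a, (a < m) -> (size ws <= count good (iota (a * Q) Q))) ->
  exists own : nat -> option T,
    (forall e w, (e %/ Q < m) -> own e = Some w -> good e /\ w \in ws) /\
    (forall a w, (a < m) -> w \in ws ->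
       \big[addb/false]_(a * Q <= e < a.+1 * Q) (own e == Some w) = true).
Proof.
move=> Q0 uws le_ws.
pose gl a := [seq e <- iota (a * Q) Q | good e].
have sgl a : (a < m) -> (size ws <= size (gl a)).
  by move=> am; rewrite size_filter le_ws.
have ugl a : uniq (gl a) by rewrite filter_uniq // iota_uniq.
pose own e := nth None (map Some ws) (index e (gl (e %/ Q))).
have ownP e w : own e = Some w -> (index e (gl (e %/ Q)) < size ws) /\
    nth w ws (index e (gl (e %/ Q))) = w.
  rewrite /own; case: (ltnP (index e (gl (e %/ Q))) (size ws)) => h.
    by rewrite (nth_map w) // => -[->].
  by rewrite nth_default ?size_map.
exists own; split=> [e w em /ownP[h hw]|a w am wws].
  have : e \in gl (e %/ Q) by rewrite -index_mem (leq_trans h) // sgl.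
  by rewrite mem_filter => /andP[-> _]; split=> //; rewrite -hw mem_nth.
have iw : (index w ws < size (gl a)).
  by rewrite (leq_trans _ (sgl a am)) // index_mem.
pose e1 := nth 0%N (gl a) (index w ws).
have e1gl : e1 \in gl a by rewrite mem_nth.
have e1r : e1 \in index_iota (a * Q) (a.+1 * Q).
  move: e1gl; rewrite mem_filter /index_iota mulSn addnK => /andP[_].
  by [].
rewrite big_seq (eq_bigr (fun e => e == e1)) => [|e].
  rewrite -big_seq (bigD1_seq e1) ?iota_uniq //= eqxx big1 // => e /negPf ->.
  by [].
rewrite mem_index_iota => /andP[lo hi].
have ea : (e %/ Q = a) by apply/eqP; rewrite eqn_leq -ltnS ltn_divLR // hi leq_divRL.
apply/eqP/eqP => [/ownP[]|->]; rewrite ?ea.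
  move=> h1 h2; rewrite /e1; have <- : index e (gl a) = index w ws.
    by rewrite -[X in _ = index X _]h2 index_uniq.
  by rewrite nth_index // -index_mem (leq_trans h1) // sgl.
have e1a : (e1 %/ Q = a).
  move: e1r; rewrite mem_index_iota => /andP[lo' hi'].
  by apply/eqP; rewrite eqn_leq -ltnS ltn_divLR // hi' leq_divRL.
rewrite /own e1a index_uniq // (nth_map w) ?index_mem // nth_index //.
Qed.

(** * The hard function *)

(* The input is a list of items [value bit; address of a pass; selector of
   coordinates; flush bit]. During a pass, the value bits of the items that
   carry the address of the pass are added to the selected coordinates of an
   accumulator [z]; a flush adds the quadratic form [qform z] to the output bit
   and clears [z]. *)
Inductive instr (J : Type) := Load | Match of bool | Add of J | Flush | Nop.
Arguments Load {J}.
Arguments Match {J}.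
Arguments Flush {J}.
Arguments Nop {J}.

(** A sum of [d] hyperbolic planes over the field with two elements. *)
Definition qform (d : nat) (z : {ffun 'I_d * bool -> bool}) : bool :=
  \big[addb/false]_(i < d) (z (i, false) && z (i, true)).

Definition state (d : nat) : finType :=
  (bool * {ffun 'I_d * bool -> bool} * bool)%type.

Definition exec (d : nat) (c : instr ('I_d * bool)) (st : state d) (b : bool) :
    state d :=
  let: (a, z, m) := st in
  match c with
  | Load => (a, z, b)
  | Match b' => (a, z, m && (b == b'))
  | Add j => (a, [ffun j' => z j' (+) [&& m, b & j' == j]], m)
  | Flush => if b then (a (+) qform z, [ffun=> false], m) else st
  | Nop => st
  end.

Definition exec_seq (d : nat) (cs : seq (instr ('I_d * bool))) (bs : seq bool)
    (st : state d) : state d :=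
  foldl (fun st p => exec p.1 st p.2) st (zip cs bs).

Definition pass_code (k i : nat) : (up_log 2 k).-tuple bool :=
  nth [tuple of nseq (up_log 2 k) false] (enum {: (up_log 2 k).-tuple bool}) i.

Lemma pass_code_inj (k i i' : nat) : i < k -> i' < k ->
  (pass_code k i == pass_code k i' :> seq bool) = (i == i').
Proof.
have kc : k <= size (enum {: (up_log 2 k).-tuple bool}).
  by rewrite -cardE card_tuple card_bool up_logP.
move=> ik ik'; rewrite val_eqE nth_uniq ?enum_uniq //.
  exact: leq_trans kc.
exact: leq_trans kc.
Qed.

Definition item_prog (k d i : nat) : seq (instr ('I_d * bool)) :=
  Load :: map Match (pass_code k i) ++
  map (@Add _) (enum {: 'I_d * bool}) ++ [:: Flush].

Definition item_size (k d : nat) : nat := up_log 2 k + 2 * d + 2.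

Lemma size_item_prog k d i : size (item_prog k d i) = item_size k d.
Proof.
have sJ : size (enum {: 'I_d * bool}) = d * 2.
  by rewrite -cardE card_prod card_ord card_bool.
rewrite /item_prog -cat1s !size_cat 2!size_map size_tuple sJ /=.
by rewrite /item_size; lia.
Qed.

Lemma exec_seq_cat d cs1 cs2 bs1 bs2 (st : state d) : size cs1 = size bs1 ->
  exec_seq (cs1 ++ cs2) (bs1 ++ bs2) st =
  exec_seq cs2 bs2 (exec_seq cs1 bs1 st).
Proof. by move=> e; rewrite /exec_seq zip_cat // foldl_cat. Qed.

Lemma exec_match d (cs bs : seq bool) a z m : size cs = size bs ->
  exec_seq (map Match cs) bs (a, z, m) = (a, z, m && (bs == cs)) :> state d.
Proof.
elim: cs bs m => [|c cs IH] [|b bs] m //=; first by rewrite andbT.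
by case=> e; rewrite /exec_seq /= -/(exec_seq _ _ _) IH // eqseq_cons andbA.
Qed.

Lemma exec_add d (js : seq ('I_d * bool)) (P : pred ('I_d * bool)) a z m :
  uniq js ->
  exec_seq (map (@Add _) js) (map P js) (a, z, m) =
  (a, [ffun j => z j (+) [&& m, P j & j \in js]], m) :> state d.
Proof.
elim: js z => [|j0 js IH] z /=.
  move=> _; congr (_, _, _); apply/ffunP => j.
  by rewrite ffunE in_nil !andbF addbF.
case/andP=> nj uj; rewrite /exec_seq /= -/(exec_seq _ _ _) IH //.
congr (_, _, _); apply/ffunP => j; rewrite !ffunE in_cons.
have [->|_] := eqVneq j j0; first by rewrite (negPf nj) !andbF !andbT addbF.
by rewrite /= !andbF addbF.
Qed.

Lemma exec_item k d i (v : bool) (tg : seq bool) (P : pred ('I_d * bool)) (F : bool)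
    a z m : size tg = up_log 2 k ->
  exec_seq (item_prog k d i)
    (v :: tg ++ map P (enum {: 'I_d * bool}) ++ [:: F]) (a, z, m) =
  exec Flush
    (a, [ffun j => z j (+) [&& v, tg == pass_code k i & P j]],
     v && (tg == pass_code k i)) F :> state d.
Proof.
move=> stg; rewrite /item_prog /exec_seq /= -/(exec_seq _ _ _).
rewrite exec_seq_cat ?size_map ?size_tuple // exec_match ?size_tuple //.
rewrite exec_seq_cat ?size_map // exec_add ?enum_uniq //.
rewrite /exec_seq /=; congr (if F then (_ (+) qform _, _, _) else (_, _, _));
  by apply/ffunP => j; rewrite !ffunE mem_enum andbT andbA.
Qed.

(** The pass [t %/ n] is hard-wired into the program; variables after the [M] items are skipped. *)
Definition item_step (n k d M t : nat) (st : state d) (b : bool) : state d :=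
  if t %% n < M * item_size k d then
    exec (nth Nop (item_prog k d (t %/ n)) (t %% n %% item_size k d)) st b
  else st.

Lemma run_exec_seq d (step : nat -> state d -> bool -> state d) bit t0 cs bs st :
  size cs = size bs ->
  (forall o st, o < size cs ->
     step (t0 + o) st (bit (t0 + o)) = exec (nth Nop cs o) st (nth false bs o)) ->
  run step bit t0 (size cs) st = exec_seq cs bs st.
Proof.
elim: cs bs t0 st => [|c cs IH] [|b bs] t0 st //= [e] h.
rewrite /run /= -/(run _ _ _ _ _).
have := h 0 st isT; rewrite addn0 /= => ->.
rewrite /exec_seq /= -/(exec_seq _ _ _); apply: IH => // o st' os.
by have := h o.+1 st'; rewrite addSnnS => ->.
Qed.

Lemma run_item n k d M bit i e bs st : e < M -> M * item_size k d <= n ->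
  size bs = item_size k d ->
  (forall o, o < item_size k d ->
     bit (i * n + e * item_size k d + o) = nth false bs o) ->
  run (item_step n k (d := d) M) bit (i * n + e * item_size k d) (item_size k d) st =
  exec_seq (item_prog k d i) bs st.
Proof.
move=> eM Mn sbs hbit; rewrite -{2}(size_item_prog k d i).
apply: run_exec_seq => [|o st']; rewrite size_item_prog // => ol.
have pM : e * item_size k d + o < M * item_size k d by nia.
have pn : e * item_size k d + o < n by lia.
have n0 : 0 < n by lia.
rewrite hbit // /item_step -addnA modnMDl modn_small // pM.
by rewrite divnMDl // divn_small // addn0 modnMDl modn_small.
Qed.

Lemma run_idle n k d M bit i st : 0 < n -> M * item_size k d <= n ->
  run (item_step n k (d := d) M) bit (i * n + M * item_size k d)
    (n - M * item_size k d) st = st.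
Proof.
move=> n0 Mn; suff h l : l <= n - M * item_size k d ->
  run (item_step n k (d := d) M) bit (i * n + M * item_size k d) l st = st by exact: h.
elim: l => // l IH ln; rewrite run_succ IH ?(ltnW ln) // /item_step.
by rewrite -addnA modnMDl modn_small ?ltnNge ?leq_addr //; lia.
Qed.

(** Item visits are numbered by [t] through all passes; this is what the visits before [T] add to
    the accumulator during block [b], the blocks being separated by flushes. *)
Definition block_sum (J : finType) (contr : nat -> J -> bool) (blk : nat -> nat)
    (b T : nat) : {ffun J -> bool} :=
  [ffun j => \big[addb/false]_(0 <= t < T | blk t == b) contr t j].

Lemma block_sumS (J : finType) (contr : nat -> J -> bool) blk b T j :
  block_sum contr blk b T.+1 j =
  block_sum contr blk b T j (+) ((blk T == b) && contr T j).
Proof.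
rewrite !ffunE big_mkcond big_nat_recr //= -big_mkcond.
by case: (blk T == b).
Qed.

(** One step of the invariant: the output bit holds the forms of the completed blocks, the
    accumulator the partial sum of the current one. *)
Lemma exec_flush_block d (contr : nat -> 'I_d * bool -> bool) (blk : nat -> nat)
    (F : bool) T m :
  blk T.+1 = F + blk T -> (forall t, t < T -> blk t <= blk T) ->
  exec Flush (\big[addb/false]_(0 <= b < blk T) qform (block_sum contr blk b T),
     [ffun j => block_sum contr blk (blk T) T j (+) contr T j], m) F =
  (\big[addb/false]_(0 <= b < blk T.+1) qform (block_sum contr blk b T.+1),
   block_sum contr blk (blk T.+1) T.+1, m) :> state d.
Proof.
move=> blkS blk_le.
have bsE : [ffun j => block_sum contr blk (blk T) T j (+) contr T j] =
    block_sum contr blk (blk T) T.+1.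
  by apply/ffunP => j; rewrite block_sumS eqxx ffunE.
have accE : \big[addb/false]_(0 <= b < blk T) qform (block_sum contr blk b T) =
    \big[addb/false]_(0 <= b < blk T) qform (block_sum contr blk b T.+1).
  apply: eq_big_nat => b /andP[_ ltb]; congr qform; apply/ffunP => j.
  by rewrite block_sumS [blk T == b]gtn_eqF // andFb addbF.
rewrite bsE accE blkS; case: F blkS => //= blkS.
rewrite add1n big_nat_recr //=; congr (_, _, _).
apply/ffunP => j; rewrite !ffunE big_nat_cond big1 // => t /andP[/andP[_ tT] /eqP e].
by move: tT; rewrite ltnS leq_eqVlt => /orP[/eqP E|/blk_le]; rewrite ?E in e *; lia.
Qed.

Lemma run_blocks n k d M bit (contr : nat -> 'I_d * bool -> bool)
    (flush : pred nat) (blk : nat -> nat) :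
  0 < n -> M * item_size k d <= n -> blk 0 = 0 ->
  (forall T, blk T.+1 = flush T + blk T) ->
  (forall i e a z m, i < k -> e < M -> exists m',
     run (item_step n k (d := d) M) bit (i * n + e * item_size k d)
       (item_size k d) (a, z, m) =
     exec Flush (a, [ffun j => z j (+) contr (i * M + e) j], m')
       (flush (i * M + e))) ->
  exists m, run (item_step n k (d := d) M) bit 0 (k * n)
              (false, [ffun=> false], false) =
    (\big[addb/false]_(0 <= b < blk (k * M))
        qform (block_sum contr blk b (k * M)),
     block_sum contr blk (blk (k * M)) (k * M), m).
Proof.
move=> n0 Mn blk0 blkS step_item.
have blk_le t T : t <= T -> blk t <= blk T.
  move/subnK <-; elim: (T - t) => // q IH; rewrite addSn blkS.
  exact: leq_trans IH (leq_addl _ _).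
pose spec T m : state d := (\big[addb/false]_(0 <= b < blk T)
  qform (block_sum contr blk b T), block_sum contr blk (blk T) T, m).
suff main i : i <= k -> exists m,
    run (item_step n k (d := d) M) bit 0 (i * n) (false, [ffun=> false], false) =
    spec (i * M) m by exact: main.
elim: i => [_|i IH ik].
  exists false; rewrite /run /= /spec blk0 big_geq //; congr (_, _, _).
  by apply/ffunP => j; rewrite !ffunE big_geq.
have inner e : e <= M -> exists m,
    run (item_step n k (d := d) M) bit 0 (i * n + e * item_size k d)
      (false, [ffun=> false], false) = spec (i * M + e) m.
  elim: e => [_|e IHe eM]; first by rewrite !addn0; apply: IH; exact: ltnW.
  have [m hm] := IHe (ltnW eM).
  rewrite mulSnr addnA run_cat add0n hm.
  have := step_item i e (spec (i * M + e) m).1.1 (spec (i * M + e) m).1.2 m ik eM.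
  case=> m' /= hm'; exists m'; rewrite hm' addnS; apply: exec_flush_block => // t /ltnW.
  exact: blk_le.
have [m hm] := inner M (leqnn M); exists m.
have -> : i.+1 * n = i * n + M * item_size k d + (n - M * item_size k d).
  by rewrite mulSnr; lia.
by rewrite run_cat add0n hm run_idle // mulSnr.
Qed.

(** * Embedding the communication problem under every order *)

Lemma big_addb_two (F : nat -> bool) (N u : nat) : u.+1 < N ->
  (forall v, v < N -> v != u -> v != u.+1 -> F v = false) ->
  \big[addb/false]_(0 <= v < N) F v = F u (+) F u.+1.
Proof.
move=> uN F0; rewrite (@big_cat_nat _ _ _ u) //=; last by lia.
rewrite [X in X (+) _]big_nat big1 => [|v /andP[_ vu]]; last by apply: F0; lia.
rewrite big_ltn; last by lia.
rewrite big_ltn // big_nat big1 ?addbF // => v /andP[uv vN].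
by apply: F0; lia.
Qed.

(** A quarter needs an item for each pass and each of the [2 * d] coordinates; the factor 2 is there
    because only half of its items are certain to lie on the desired side of the cut. *)
Definition quarter_size (k d : nat) : nat := 2 * (k * (2 * d)).

Definition shuffled_form (n k d : nat) : n.-tuple bool -> bool :=
  automaton_fun k (item_step n k (d := d) (4 * quarter_size k d))
    (false, [ffun=> false], false) (fun st => st.1.1).

(** The [k.+1] passes visit quarters [4 * k.+1] times. The visits are grouped into consecutive pairs
    of opposite colours, one adding a part of [x] and the other the same part of [y]; the flush
    after a pair evaluates the form at their sum. With [delta = true] both end visits stay single,
    so only blocks 1 to [k.*2.+1] carry data. *)
Lemma shuffled_form_embeds_had (n k d : nat) (pi : {perm 'I_n}) :
  0 < d -> 4 * quarter_size k.+1 d * item_size k.+1 d <= n ->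
  embeds_had (@shuffled_form n k.+1 d) pi ('I_(k.*2.+1) * 'I_d)%type.
Proof.
move=> d0; rewrite /shuffled_form /quarter_size.
set K := k.+1 * (2 * d); set Q := 2 * K; set M := 4 * Q; set ell := item_size _ _.
move=> hn.
have K0 : 0 < K by rewrite muln_gt0 muln_gt0 d0.
have Q0 : 0 < Q by rewrite muln_gt0.
have ell0 : 0 < ell by rewrite /ell /item_size addn2.
have n0 : 0 < n by apply: leq_trans hn; rewrite muln_gt0 ell0 muln_gt0 Q0.
case: n pi hn n0 => // n pi hn n0.
(* The position in the order of the value bit of item [e], the only bit of the item that will depend
   on [x] or [y]. *)
pose rank e : nat := (pi^-1)%g (inord (e * ell)).
have item_lt e : e < M -> e * ell < n.+1.
  by move=> eM; apply: leq_trans hn; rewrite ltn_pmul2r.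
have [l [col [delta [ln hcol hcount]]]] :
  exists (l : nat) (col : nat -> bool) (delta : bool),
    [/\ l <= n.+1,
        forall u, ~~ odd (u + delta) -> col (u %% 4) = ~~ col (u.+1 %% 4) &
        forall a, a < 4 ->
          K <= count (fun e => (rank e < l) == col a) (iota (a * Q) Q)].
  apply: exists_balanced_cut => // [e _|e e' eM eM' /val_inj /perm_inj].
    exact: ltn_ord.
  move/(congr1 val).
  by rewrite /= !inordK ?item_lt // => /eqP; rewrite eqn_pmul2r // => /eqP.
pose J : finType := ('I_d * bool)%type.
pose ws := [seq (i, j) | i <- iota 0 k.+1, j <- enum J].
have uws : uniq ws.
  by apply: allpairs_uniq; rewrite ?iota_uniq ?enum_uniq // => -[? ?] [? ?].
have sws : size ws = K.
  by rewrite size_allpairs size_iota -cardE card_prod card_ord card_bool mulnC /K; lia.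
pose good e := (rank e < l) == col (e %/ Q).
have [own [own_good own_sum]] : exists own : nat -> option (nat * J),
    (forall e w, e %/ Q < 4 -> own e = Some w -> good e /\ w \in ws) /\
    (forall a w, a < 4 -> w \in ws ->
       \big[addb/false]_(a * Q <= e < a.+1 * Q) (own e == Some w) = true).
  apply: exists_owner => // a a4; rewrite sws (leq_trans (hcount a a4)) //.
  rewrite leq_eqVlt; apply/orP; left; apply/eqP; apply: eq_in_count => e.
  rewrite mem_iota => /andP[lo hi]; rewrite /good.
  by have -> : e %/ Q = a by apply/eqP; rewrite eqn_leq -ltnS ltn_divLR // leq_divRL // lo andbT; nia.
pose X := {ffun 'I_(k.*2.+1) * 'I_d -> bool * bool}.
pose coord (x : X) b (j : J) := let p := x (inord b, j.1) in if j.2 then p.2 else p.1.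
pose value (x y : X) u j := let b := (u + delta) %/ 2 in
  (0 < b < k.+1.*2) && coord (if col (u %% 4) then x else y) b.-1 j.
pose vbit x y e := if own e is Some w then value x y (4 * w.1 + e %/ Q) w.2 else false.
(* An item without owner gets value bit 0 and stays inactive. The flush pattern has period [2 * Q],
   which divides [M], so it is the same in every pass. *)
pose ibits x y e := vbit x y e :: pass_code k.+1 (if own e is Some w then w.1 else 0) ++
  map (fun j : J => if own e is Some w then j == w.2 else false) (enum J) ++
  [:: 2 * Q %| (e + delta * Q).+1].
pose s x y : n.+1.-tuple bool := [tuple
  (if p < M * ell then nth false (ibits x y (p %/ ell)) (p %% ell) else false) | p < n.+1].
(* Only value bits vary, and a good item lies on the side of the cut given by the colour of its
   quarter. *)
have indep (c : bool) (p : 'I_n.+1) x y x' y' : (p < l) = c ->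
    (if c then x = x' else y = y') -> tnth (s x y) (pi p) = tnth (s x' y') (pi p).
  move=> pl exy; rewrite !tnth_mktuple; case: ifP => // pM.
  case ho : (pi p %% ell) => [|o] //=.
  have pe : pi p = pi p %/ ell * ell :> nat by rewrite {1}(divn_eq (pi p) ell) ho addn0.
  have eM : pi p %/ ell < M by rewrite ltn_divLR.
  have eQ : pi p %/ ell %/ Q < 4 by rewrite ltn_divLR.
  rewrite /vbit; case e_own : (own _) => [w|] //.
  have [/eqP gd _] := own_good _ _ eQ e_own.
  have rp : rank (pi p %/ ell) = p.
    by rewrite /rank -pe inord_val permK.
  rewrite /value mulnC modnMDl modn_small // -gd rp pl.
  by case: c exy {pl gd} => ->.
exists l, s; split=> // [p pl x y y'|p pl x x' y|x y].
- exact: (indep true).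
- by apply: (indep false) => //; rewrite ltnNge pl.
pose contr T j := (own (T %% M) == Some (T %/ M, j)) && value x y (T %/ Q) j.
pose blk T := (T + delta * Q) %/ (2 * Q).
pose flush T := 2 * Q %| (T + delta * Q).+1.
rewrite /automaton_fun.
set bit := fun t => nth false _ _.
have [|||m ->] := @run_blocks n.+1 k.+1 d M bit contr flush blk n0 hn.
- by rewrite /blk divn_small //; case: (delta); lia.
- by move=> T; rewrite /blk addSn divnS ?muln_gt0.
- move=> i e a z m ik eM; eexists.
  rewrite (run_item (bs := ibits x y e)) //; first last.
  + move=> o ol; have pM : e * ell + o < M * ell by nia.
    have pn : e * ell + o < n.+1 by exact: leq_trans hn.
    rewrite /bit -addnA modnMDl modn_small // (nth_mktuple _ _ (Ordinal pn)) /= pM.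
    by rewrite divnMDl // divn_small // addn0 modnMDl modn_small.
  + have sJ : size (enum J) = d * 2 by rewrite -cardE card_prod card_ord card_bool.
    by rewrite /ibits -cat1s !size_cat size_map size_tuple sJ /= /item_size; lia.
  rewrite exec_item ?size_tuple //.
  have -> : flush (i * M + e) = (2 * Q %| (e + delta * Q).+1).
    rewrite /flush -addnA -addnS dvdn_addr // /M.
    by apply/dvdnP; exists (i * 2); lia.
  congr (exec Flush (_, _, _) _); apply/ffunP => j; rewrite !ffunE; congr (_ (+) _).
  have TQ : (i * M + e) %/ Q = 4 * i + e %/ Q.
    by rewrite /M mulnA divnMDl // [i * 4]mulnC.
  rewrite /contr modnMDl modn_small // divnMDl ?(leq_trans _ eM) // divn_small //.
  rewrite addn0 TQ /vbit; case e_own : (own e) => [[i' j']|] //=.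
  have eQ : e %/ Q < 4 by rewrite ltn_divLR.
  have [_ /allpairsP[p [hi1 _ [ei1 _]]]] := own_good _ _ eQ e_own.
  have i'k : i' < k.+1 by move: hi1; rewrite mem_iota -ei1.
  rewrite pass_code_inj // [Some _ == _]/eq_op /= xpair_eqE.
  have [->|_] := eqVneq i' i; last by rewrite andbF.
  have [->|_] := eqVneq j' j; first by rewrite /= andbT.
  by rewrite !andbF.
have blkE : blk (k.+1 * M) = k.+1.*2.
  rewrite /blk /M -muln2 (_ : _ + _ = k.+1 * 2 * (2 * Q) + delta * Q); last by lia.
  by rewrite divnMDl ?muln_gt0 // divn_small ?addn0 //; case: (delta); lia.
(* In one visit of a quarter exactly one item serves this pass and coordinate [j], so the sum over
   items collapses to a sum over visits. *)
have bsE b j : block_sum contr blk b (k.+1 * M) j =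
    \big[addb/false]_(0 <= u < 4 * k.+1) (((u + delta) %/ 2 == b) && value x y u j).
  rewrite ffunE big_mkcond /=.
  rewrite (_ : k.+1 * M = 4 * k.+1 * Q); last by rewrite /M; lia.
  rewrite big_nat_mul; apply: eq_big_nat => u /andP[_ uk].
  have uk4 : u %/ 4 < k.+1 by rewrite ltn_divLR // mulnC.
  have u4 : u %% 4 < 4 by rewrite ltn_pmod.
  have wws : (u %/ 4, j) \in ws by apply: allpairs_f; rewrite ?mem_iota ?mem_enum.
  transitivity (\big[addb/false]_((u %% 4) * Q <= e < (u %% 4).+1 * Q)
     ((own e == Some (u %/ 4, j)) && (((u + delta) %/ 2 == b) && value x y u j))).
    rewrite -{1}[u * Q]add0n -[u %% 4 * Q]add0n !big_addn !mulSn !addnK.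
    apply: eq_big_nat => q /andP[_ qQ].
    have TQ : (q + u * Q) %/ Q = u by rewrite addnC divnMDl // divn_small // addn0.
    have TM : (q + u * Q) %/ M = u %/ 4 by rewrite /M [4 * Q]mulnC divnMA TQ.
    have Tm : (q + u * Q) %% M = q + (u %% 4) * Q.
      rewrite {1}(divn_eq u 4) /M.
      rewrite (_ : q + _ = u %/ 4 * (4 * Q) + (q + u %% 4 * Q)); last by lia.
      by rewrite modnMDl modn_small //; nia.
    have TB : blk (q + u * Q) = (u + delta) %/ 2.
      rewrite /blk [2 * Q]mulnC divnMA -addnA -mulnDl.
      by rewrite [q + _]addnC divnMDl // (divn_small qQ) addn0.
    by rewrite TB /contr TQ TM Tm; case: eqP; rewrite ?andbF.
  case: (_ && value x y u j); last by rewrite big1 // => e _; rewrite andbF.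
  by under eq_bigr do rewrite andbT; rewrite own_sum.
rewrite /= blkE doubleS big_nat_recl //.
have -> : block_sum contr blk 0 (k.+1 * M) = [ffun=> false].
  apply/ffunP => j; rewrite bsE ffunE big1 // => u _; rewrite /value.
  by case: eqP => // ->.
rewrite {1}/qform big1 ?addFb => [|i _]; last by rewrite !ffunE.
(* Block [b.+1] consists of visit [b.+1.*2 - delta] and the next one, whose quarters have opposite
   colours. *)
have coordE b j : b < k.*2.+1 ->
    block_sum contr blk b.+1 (k.+1 * M) j = coord x b j (+) coord y b j.
  move=> bk; rewrite bsE (@big_addb_two _ _ (b.+1.*2 - delta)); first last.
  - move=> v _ v1 v2; apply/negbTE; rewrite negb_and; apply/orP; left.
    by apply/negP => /eqP; case: (delta) v1 v2; lia.
  - by case: (delta); lia.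
  have -> : (b.+1.*2 - delta + delta) %/ 2 = b.+1 by case: (delta); lia.
  have -> : ((b.+1.*2 - delta).+1 + delta) %/ 2 = b.+1 by case: (delta); lia.
  rewrite eqxx /value /=.
  have -> : (b.+1.*2 - delta + delta) %/ 2 = b.+1 by case: (delta); lia.
  have -> : ((b.+1.*2 - delta).+1 + delta) %/ 2 = b.+1 by case: (delta); lia.
  have -> : b.+1 < k.+1.*2 by lia.
  rewrite (hcol (b.+1.*2 - delta)); last first.
    by rewrite subnK ?odd_double //; case: (delta); lia.
  by case: (col _); rewrite //= addbC.
rewrite big_mkord /had.
rewrite (eq_bigr (fun e => quad (x (e.1, e.2)) (y (e.1, e.2)))) => [|[]//].
rewrite -(pair_bigA _ (fun b i => quad (x (b, i)) (y (b, i)))) /=.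
apply: eq_bigr => b _; apply: eq_bigr => i _.
by rewrite !coordE ?ltn_ord // /coord /quad /= inord_val.
Qed.

(** * Choice of parameters *)

(** [16 * 4 ^ d > 3 * w >= 48 * W] makes [4 ^ d] exceed [3 * W], and [3 ^ m >= 27] absorbs the
    factor 4. *)
Lemma nobdd_width_numeric (w d m W : nat) : 3 <= m -> 0 < w ->
  3 * w < 16 * 4 ^ d -> 16 * W <= w -> 4 * W ^ m < 4 ^ (m * d).
Proof.
move=> m3 w0 wd Ww; rewrite mulnC [m * d]mulnC expnM.
have m0 : 0 < m by exact: leq_trans m3.
have lt1 : (3 * w) ^ m < 16 ^ m * (4 ^ d) ^ m by rewrite -expnMn ltn_exp2r.
have le1 : 16 ^ m * W ^ m <= w ^ m by rewrite -expnMn leq_exp2r.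
have le3 : 3 ^ 3 <= 3 ^ m by rewrite leq_pexp2l.
rewrite -(@ltn_pmul2l (16 ^ m)) ?expn_gt0 //; apply: leq_ltn_trans lt1.
rewrite expnMn mulnA mulnC; apply: leq_mul => //.
exact: leq_trans le3.
Qed.

(** With [V = maxn W 1], [(W ^ m).+1 <= 2 * V ^ m]; then [16 * 4 ^ d > 3 * w >= 108 * V ^ 2] and
    [108 ^ 3 >= 36 * 16 ^ 3] suffice. *)
Lemma pobdd_width_numeric (w d m W : nat) : 3 <= m -> 36 <= w ->
  3 * w < 16 * 4 ^ d -> 36 * W ^ 2 <= w -> 9 * (W ^ m).+1 ^ 2 < 4 ^ (m * d).
Proof.
move=> m3 w0 wd Ww; rewrite [m * d]mulnC expnM.
have m0 : 0 < m by exact: leq_trans m3.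
pose V := maxn W 1.
have Vw : 36 * V ^ 2 <= w by rewrite /V; case: (leqP W 1) => // W1; nia.
have V1 : 0 < V ^ m by rewrite expn_gt0 leq_max orbT.
have WV : W ^ m <= V ^ m by rewrite leq_exp2r // leq_maxl.
have le36 : 9 * (W ^ m).+1 ^ 2 <= 36 * (V ^ 2) ^ m.
  by rewrite expnAC; nia.
apply: (leq_ltn_trans le36); rewrite -(@ltn_pmul2l (16 ^ m)) ?expn_gt0 //.
have lt1 : (3 * w) ^ m < 16 ^ m * (4 ^ d) ^ m by rewrite -expnMn ltn_exp2r.
apply: leq_ltn_trans lt1.
apply: (@leq_trans ((108 * V ^ 2) ^ m)); last by rewrite leq_exp2r //; lia.
rewrite expnMn mulnA leq_mul2r; apply/orP; right.
rewrite -(subnKC m3) !expnD mulnAC; apply: leq_mul; first by [].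
by case: (m - 3) => // q; rewrite leq_exp2r.
Qed.

(** From [d.+1 <= 2 ^ d] follows [4 * d.+1 ^ 2 <= 3 * w + 1], hence [8 * d <= w] as [w >= 64]; so
    the [16 * k * d] items number at most [2 * k * w]. *)
Lemma shuffled_form_size (w k d n : nat) : 64 <= w -> 4 ^ d.+1 <= 3 * w + 1 ->
  2 * k * w * (2 * w + up_log 2 k + up_log 2 (2 * w)) < n ->
  4 * quarter_size k d * item_size k d <= n.
Proof.
move=> w64 dw hn; apply: leq_trans (ltnW hn).
have d2 : d < 2 ^ d by exact: ltn_expl.
have d4 : 4 * (d.+1 * d.+1) <= 3 * w + 1.
  apply: leq_trans dw; rewrite expnS (_ : 4 ^ d = 2 ^ d * 2 ^ d) -?expnMn //.
  by rewrite expnMn leq_mul2l leq_mul.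
have d8 : 8 * d <= w by nia.
rewrite /quarter_size /item_size.
rewrite (_ : 4 * (2 * (k * (2 * d))) = 2 * k * (8 * d)); last by lia.
apply: leq_mul; first by rewrite leq_mul2l d8 orbT.
by lia.
Qed.

Lemma card_state d : #|state d| = 4 ^ d.+1.
Proof.
rewrite !card_prod card_ffun card_prod card_ord card_bool [d * 2]mulnC expnM.
by rewrite [4 ^ _]expnS -[2 ^ 2]/4; lia.
Qed.

Local Open Scope ring_scope.

Theorem theorem5 (R : realType) (n k w : nat)
  (hk : (2 <= k)%N) (hw : (64 <= w)%N)
  (hsqrt : 1 <= Num.sqrt (w%:R : R) / (log2 (k%:R : R) * log2 (w%:R : R)))
  (hn : (2 * k * w * (2 * w + up_log 2 k + up_log 2 (2 * w)) < n)%N) :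
  exists f : n.-tuple bool -> bool,
    [/\ kOBDD k ((3 * w + 1)%N%:R : R) f,
        kNOBDD k ((3 * w + 1)%N%:R : R) f &
        kPOBDD k ((3 * w + 1)%N%:R : R) f] /\
    [/\ ~ kOBDD k ((w %/ 16 - 3)%N%:R : R) f,
        ~ kNOBDD k (Num.sqrt (w%:R : R) / 2) f &
        ~ kPOBDD k
            (Num.sqrt (w%:R : R) / (log2 (k%:R : R) * log2 (w%:R : R))) f].
Proof.
(* [4 ^ d.+1] is the largest power of 4 up to [3 * w + 1]; [w >= 64] makes [d] positive. *)
have [d [d0 dle dlt]] : exists d, [/\ (0 < d)%N, (4 ^ d.+1 <= 3 * w + 1)%N &
    (3 * w + 1 < 4 ^ d.+2)%N].
  have w1 : (0 < 3 * w + 1)%N by rewrite addn1.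
  have := trunc_log_bounds (isT : (1 < 4)%N) w1.
  have : (2 <= trunc_log 4 (3 * w + 1))%N by rewrite trunc_log_max //; lia.
  case: trunc_log => [|[|d]] // _ /andP[h1 h2].
  by exists d.+1.
have {}dlt : (3 * w < 16 * 4 ^ d)%N by move: dlt; rewrite !expnS; lia.
case: k hk hsqrt hn => [|[|k]] // _ _ hn.
have hM := shuffled_form_size hw dle hn.
have m3 : (3 <= k.+1.*2.+1)%N by lia.
have cE : #|{: 'I_k.+1.*2.+1 * 'I_d}| = (k.+1.*2.+1 * d)%N.
  by rewrite card_prod !card_ord.
(* A deterministic diagram is also a nondeterministic one, so this settles both models. *)
have not_nobdd (P : knobdd n k.+2) : (16 * width P <= w)%N ->
    ~ (forall s, @shuffled_form n k.+2 d s <-> accepts P s).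
  move=> Pw hP; have := shuffled_form_embeds_had (nobdd_order P) d0 hM.
  move=> /(knobdd_width_ge _ hP); rewrite cE muln_gt0 d0 => /(_ isT).
  by rewrite leqNgt (nobdd_width_numeric (w := w)) //; lia.
have Sw : #|state d|%:R <= (3 * w + 1)%N%:R :> R by rewrite ler_nat card_state.
have hO : kOBDD k.+2 ((3 * w + 1)%N%:R : R) (@shuffled_form n k.+2 d).
  exact: automaton_kOBDD.
exists (@shuffled_form n k.+2 d); split; split.
- exact: hO.
- by have [P [_ PW hP]] := hO; exists P.
- exact: automaton_kPOBDD.
- move=> [P [_ PW hP]]; apply: not_nobdd hP.
  by move: PW; rewrite ler_nat; lia.
- move=> [P [PW hP]]; apply: not_nobdd hP.
  (* This gives [16 * width P <= w]: directly for widths at least 4, and by [w >= 64] for smaller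
     ones. *)
  have : (4 * width P ^ 2 <= w)%N.
    rewrite -(ler_nat R) natrM natrX -(@sqr_sqrtr R w%:R) ?ler0n //.
    have : (2 * (width P)%:R) ^+ 2 <= Num.sqrt (w%:R : R) ^+ 2.
      by rewrite ler_pXn2r ?nnegrE ?mulr_ge0 ?sqrtr_ge0 // -ler_pdivlMl // mulrC.
    by rewrite exprMn; lra.
  by nia.
move=> [P [PW hP]]; have := shuffled_form_embeds_had (pobdd_order P) d0 hM.
move=> /(kpobdd_width_ge hP); rewrite cE leqNgt (pobdd_width_numeric (w := w)) //; first by lia.
have ln2 : 0 < ln 2 :> R by rewrite ln_gt0 // ltr1n.
have log2_ge (a b : nat) : (2 ^ a <= b)%N -> a%:R <= log2 (b%:R : R).
  move=> ab; rewrite /log2 ler_pdivlMr // mulr_natl -lnXn // -natrX.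
  rewrite ler_ln ?posrE ?ltr0n ?ler_nat ?expn_gt0 //.
  by apply: leq_trans ab; rewrite expn_gt0.
(* The logarithms are at least 1 and 6, so the width is at most a sixth of the square root of
   [w]. *)
have L6 : 6 <= log2 (k.+2%:R : R) * log2 (w%:R : R).
  by rewrite -[leLHS]mul1r ler_pM // ?(log2_ge 1%N) ?(log2_ge 6%N).
rewrite -(ler_nat R) natrM natrX -(@sqr_sqrtr R w%:R) ?ler0n //.
have : (6 * (width P)%:R) ^+ 2 <= Num.sqrt (w%:R : R) ^+ 2.
  rewrite ler_pXn2r ?nnegrE ?mulr_ge0 ?sqrtr_ge0 //.
  move: PW; rewrite ler_pdivlMr; last by apply: lt_le_trans L6.
  apply: le_trans; rewrite mulrC ler_wpM2l //.
by rewrite exprMn; lra.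
Qed.
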